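(* Let $p$ be a prime, let $C,\gamma>0$, and let $(\rho_t^{(p)},t\ge0)$ be the convolution semigroup of probability measures on $\mathbb{Q}_p$ determined by $$\widehat{\rho_t^{(p)}}(\chi_y)=\exp\{-Ct|y|_p^{\gamma}\},\qquad y\in\mathbb{Q}_p,\ t\ge0.$$ Then for every $t>0$ the measure $\rho_t^{(p)}$ has a continuous density with respect to Haar measure on $\mathbb{Q}_p$, namely $$f_t^{(p)}(x)=\int_{\mathbb{Q}_p}\chi_y(x)e^{-Ct|y|_p^{\gamma}}\,dy,\qquad x\in\mathbb{Q}_p.$$
   Context: $\mathbb{Q}_p$ is the additive group of $p$-adic numbers with the $p$-adic norm $|\cdot|_p$ ($|p|_p=1/p$), and Haar measure is normalized so that $\mathbb{Z}_p=\{x:|x|_p\le1\}$ has mass $1$. For $x\in\mathbb{Q}_p$, $[x]$ denotes the $p$-adic fractional part of $x$, so that $x-[x]\in\mathbb{Z}_p$. The characters of $\mathbb{Q}_p$ are $\chi_y(x)=e^{2\pi i[xy]}$, $y\in\mathbb{Q}_p$. The Fourier transform of a finite Borel measure $\mu$ on $\mathbb{Q}_p$ is $\widehat{\mu}(\chi_y)=\int_{\mathbb{Q}_p}\chi_y(-x)\,\mu(dx)$. The existence, for all $C,\gamma>0$, of the convolution semigroup $(\rho_t^{(p)})$ is known. *)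

(* Defs.v *)
From HB Require Import structures.
From mathcomp Require Import all_boot all_order all_algebra.
From mathcomp Require Import fraction complex.
From mathcomp Require Import all_classical all_reals all_analysis.

Set Implicit Arguments.
Unset Strict Implicit.
Unset Printing Implicit Defensive.

Import Order.TTheory GRing.Theory Num.Theory.
Import numFieldNormedType.Exports.

Local Open Scope classical_set_scope.
Local Open Scope ring_scope.

Section PadicInt.
Variables (p : nat) (hp : prime p).

(** Z_p as the inverse limit of the rings Z/p^n: [x n] is the residue of [x]
    modulo [p ^ n]. The proof [hp] is carried by the type so that the ring
    instances below can be canonical. *)
Record padic_int (hp0 : prime p) := PadicInt {
  residue :> nat -> nat;
  _ : `[< forall n, residue n = (residue n.+1 %% p ^ n)%N >] }.

HB.instance Definition _ := [isSub for @residue hp].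
HB.instance Definition _ := [Choice of padic_int hp by <:].

Implicit Types x y z : padic_int hp.

Lemma residueS x n : x n = (x n.+1 %% p ^ n)%N.
Proof. by case: x => x /= /asboolP. Qed.

Lemma padic_int_ext x y : (forall n, x n = y n) -> x = y.
Proof. by move=> xy; apply/val_inj/funext. Qed.

Lemma residue_mod x k n : (k <= n)%N -> x k = (x n %% p ^ k)%N.
Proof.
elim: n => [|n IH]; first by rewrite leqn0 => /eqP ->; rewrite residueS modn_mod.
rewrite leq_eqVlt => /predU1P[->|]; first by rewrite residueS modn_mod.
by rewrite ltnS => kn; rewrite (IH kn) (residueS x n) modn_dvdm // dvdn_exp2l.
Qed.

Lemma residue_modn x n : (x n %% p ^ n)%N = x n.
Proof. by rewrite -residue_mod. Qed.

Lemma padic_mk_proof (f : nat -> nat) :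
  (forall n, f n.+1 = f n %[mod p ^ n]) ->
  `[< forall n, (f n %% p ^ n = (f n.+1 %% p ^ n.+1) %% p ^ n)%N >].
Proof.
by move=> fE; apply/asboolP => n; rewrite modn_dvdm ?dvdn_exp2l // fE.
Qed.

Definition padic_mk (f : nat -> nat) (fE : forall n, f n.+1 = f n %[mod p ^ n])
  : padic_int hp := PadicInt hp (padic_mk_proof fE).

Lemma residueE x n : x n.+1 = x n %[mod p ^ n].
Proof. by rewrite residue_modn -residueS. Qed.

Definition padic_nat (m : nat) := @padic_mk (fun=> m) (fun=> erefl).

Lemma padic_add_proof x y n :
  (x n.+1 + y n.+1)%N = (x n + y n)%N %[mod p ^ n].
Proof. by rewrite -modnDm !residueE modnDm. Qed.
Definition padic_add x y := padic_mk (padic_add_proof x y).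

Lemma padic_mul_proof x y n :
  (x n.+1 * y n.+1)%N = (x n * y n)%N %[mod p ^ n].
Proof. by rewrite -modnMm !residueE modnMm. Qed.
Definition padic_mul x y := padic_mk (padic_mul_proof x y).

(** [- x = (p ^ n - 1) * x] modulo [p ^ n]. *)
Lemma padic_opp_proof x n :
  ((p ^ n.+1).-1 * x n.+1)%N = ((p ^ n).-1 * x n)%N %[mod p ^ n].
Proof.
have pn k : (0 < p ^ k)%N by rewrite expn_gt0 prime_gt0.
rewrite -modnMm residueE modnMm.
apply/eqP; rewrite -(eqn_modDr (x n)) -!mulSnr !prednK //.
by rewrite expnSr -mulnA !modnMr.
Qed.
Definition padic_opp x := padic_mk (padic_opp_proof x).

Lemma padic_addA : associative padic_add.
Proof.
by move=> x y z; apply: padic_int_ext => n /=; rewrite modnDml modnDmr addnA.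
Qed.
Lemma padic_addC : commutative padic_add.
Proof. by move=> x y; apply: padic_int_ext => n /=; rewrite addnC. Qed.
Lemma padic_add0 : left_id (padic_nat 0) padic_add.
Proof.
by move=> x; apply: padic_int_ext => n /=; rewrite modnDml add0n residue_modn.
Qed.
Lemma padic_addN : left_inverse (padic_nat 0) padic_opp padic_add.
Proof.
move=> x; apply: padic_int_ext => n /=.
by rewrite modnDml -mulSnr prednK ?expn_gt0 ?prime_gt0 // modnMr mod0n.
Qed.
HB.instance Definition _ := GRing.isZmodule.Build (padic_int hp)
  padic_addA padic_addC padic_add0 padic_addN.

Lemma padic_mulA : associative padic_mul.
Proof.
by move=> x y z; apply: padic_int_ext => n /=; rewrite modnMml modnMmr mulnA.
Qed.
Lemma padic_mulC : commutative padic_mul.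
Proof. by move=> x y; apply: padic_int_ext => n /=; rewrite mulnC. Qed.
Lemma padic_mul1 : left_id (padic_nat 1) padic_mul.
Proof.
by move=> x; apply: padic_int_ext => n /=; rewrite modnMml mul1n residue_modn.
Qed.
Lemma padic_mulD : left_distributive padic_mul padic_add.
Proof.
move=> x y z; apply: padic_int_ext => n /=.
by rewrite modnMml modnDm mulnDl.
Qed.
Lemma padic_1neq0 : padic_nat 1 != 0.
Proof.
apply/eqP => /(congr1 (fun x : padic_int hp => x 1%N)) /=.
by rewrite mod0n expn1 modn_small // prime_gt1.
Qed.
HB.instance Definition _ := GRing.Zmodule_isComNzRing.Build (padic_int hp)
  padic_mulA padic_mulC padic_mul1 padic_mulD padic_1neq0.

Lemma residue0 n : (0 : padic_int hp) n = 0%N.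
Proof. exact: mod0n. Qed.

Lemma residueD x y n : (x + y) n = ((x n + y n) %% p ^ n)%N.
Proof. by []. Qed.

Lemma residueM x y n : (x * y) n = ((x n * y n) %% p ^ n)%N.
Proof. by []. Qed.

Lemma residue_natr m n : (m%:R : padic_int hp) n = (m %% p ^ n)%N.
Proof.
elim: m => [|m IH]; first by rewrite residue0 mod0n.
by rewrite mulrSr residueD IH modnDm addn1.
Qed.

Lemma padic_neq0P x : x != 0 -> exists n, x n.+1 != 0%N.
Proof.
move=> /eqP x0; apply: contrapT => /forallNP xn; apply: x0.
apply: padic_int_ext => n; rewrite residue0; apply/eqP/negPn/negP => xn0.
case: n => [|n] in xn0; last exact: (xn n).
by move: xn0; rewrite -residue_modn expn0 modn1.
Qed.

(** The exponent of the largest power of [p] dividing [x], and 0 if [x = 0]. *)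
Definition padic_zval x : nat :=
  if pselect (exists n, x n.+1 != 0%N) is left e then ex_minn e else 0%N.

Lemma residue_eq0 x k n : (k <= n)%N -> (x k == 0%N) = (p ^ k %| x n)%N.
Proof. by move=> kn; rewrite (residue_mod x kn). Qed.

Lemma padic_zvalP x k : x != 0 -> (x k == 0%N) = (k <= padic_zval x)%N.
Proof.
move=> x0; rewrite /padic_zval; case: pselect => [e|]; last first.
  by move/(_ (padic_neq0P x0)).
case: ex_minnP => v xv vmin; apply/eqP/idP => [xk0|kv].
- rewrite leqNgt; apply/negP => vk; move: xv.
  by rewrite (residue_mod x vk) xk0 mod0n.
- case: k kv => [|k] kv; first by rewrite -residue_modn expn0 modn1.
  apply/eqP/negPn/negP => xk; have := vmin _ xk; by rewrite leqNgt kv.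
Qed.

Lemma logn_residue x n : x != 0 -> (padic_zval x < n)%N ->
  (0 < x n)%N /\ logn p (x n) = padic_zval x.
Proof.
move=> x0 vn; have xn : (0 < x n)%N.
  by rewrite lt0n (padic_zvalP _ x0) -ltnNge.
split=> //; apply/eqP; rewrite eqn_leq; apply/andP; split.
- rewrite leqNgt -pfactor_dvdn // -residue_eq0 // padic_zvalP //.
  by rewrite -ltnNge.
- by rewrite -pfactor_dvdn // -residue_eq0 ?padic_zvalP // ltnW.
Qed.

Lemma padic_mul_residue_neq0 x y n : x != 0 -> y != 0 ->
  (padic_zval x + padic_zval y < n)%N -> (x * y) n != 0%N.
Proof.
move=> x0 y0 n_gt.
have [xn vx] : (0 < x n)%N /\ logn p (x n) = padic_zval x.
  by apply: logn_residue => //; apply: leq_ltn_trans n_gt; rewrite leq_addr.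
have [yn vy] : (0 < y n)%N /\ logn p (y n) = padic_zval y.
  by apply: logn_residue => //; apply: leq_ltn_trans n_gt; rewrite leq_addl.
rewrite residueM -/(dvdn _ _) pfactor_dvdn ?muln_gt0 ?xn //.
by rewrite lognM // vx vy -ltnNge.
Qed.

Lemma padic_mulf_eq0 x y : x * y = 0 -> (x == 0) || (y == 0).
Proof.
move=> xy0; case: (eqVneq x 0) => //= x0; apply/negPn/negP => y0.
have := padic_mul_residue_neq0 x0 y0 (ltnSn _).
by rewrite xy0 residue0.
Qed.

Lemma padic_zvalM x y : x != 0 -> y != 0 ->
  padic_zval (x * y) = (padic_zval x + padic_zval y)%N.
Proof.
move=> x0 y0; set k := (_ + _)%N.
have xy0 : x * y != 0.
  by apply/negP => /eqP /padic_mulf_eq0; rewrite (negPf x0) (negPf y0).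
apply/eqP; rewrite eqn_leq; apply/andP; split.
- rewrite leqNgt -padic_zvalP //; apply: padic_mul_residue_neq0 => //.
- rewrite -padic_zvalP // residueM -/(dvdn _ _) /k expnD dvdn_mul //.
  + by rewrite -residue_eq0 ?padic_zvalP // leq_addr.
  + by rewrite -residue_eq0 ?padic_zvalP // leq_addl.
Qed.

Definition padic_unit : pred (padic_int hp) :=
  fun x => `[< exists y, y * x = 1 >].
Definition padic_inv x : padic_int hp :=
  if pselect (exists y, y * x = 1) is left e then projT1 (cid e) else x.

Lemma padic_mulV : {in padic_unit, left_inverse 1 padic_inv *%R}.
Proof.
move=> x /asboolP ux; rewrite /padic_inv; case: pselect => // e.
by case: (cid e).
Qed.
Lemma padic_unitP x y : y * x = 1 -> padic_unit x.
Proof. by move=> yx; apply/asboolP; exists y. Qed.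
Lemma padic_inv_out : {in [predC padic_unit], padic_inv =1 id}.
Proof.
move=> x; rewrite inE => /asboolPn xu; rewrite /padic_inv.
by case: pselect.
Qed.
HB.instance Definition _ := GRing.ComNzRing_hasMulInverse.Build (padic_int hp)
  padic_mulV padic_unitP padic_inv_out.
HB.instance Definition _ :=
  GRing.ComUnitRing_isIntegral.Build (padic_int hp) padic_mulf_eq0.

Definition padic_znorm x : rat :=
  if x == 0 then 0 else p%:R ^- padic_zval x.

Lemma pQ_gt0 : 0 < p%:R :> rat.
Proof. by rewrite ltr0n prime_gt0. Qed.

Lemma padic_znorm_ge0 x : 0 <= padic_znorm x.
Proof.
by rewrite /padic_znorm; case: ifP => // _; rewrite invr_ge0 exprn_ge0 ?ler0n.
Qed.

Lemma padic_znorm_eq0 x : (padic_znorm x == 0) = (x == 0).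
Proof.
rewrite /padic_znorm; case: ifP => [|_]; first by rewrite eqxx.
by rewrite invr_eq0 expf_eq0 gt_eqF ?pQ_gt0 ?andbF.
Qed.

Lemma padic_znorm0 : padic_znorm 0 = 0.
Proof. by rewrite /padic_znorm eqxx. Qed.

Lemma padic_znormM x y : padic_znorm (x * y) = padic_znorm x * padic_znorm y.
Proof.
rewrite /padic_znorm mulf_eq0; case: eqVneq => [_|x0] /=; first by rewrite mul0r.
case: eqVneq => [_|y0] /=; first by rewrite mulr0.
by rewrite padic_zvalM // exprD invfM.
Qed.

Lemma padic_znorm_le x k : (padic_znorm x <= p%:R ^- k) = (x k == 0%N).
Proof.
rewrite /padic_znorm; case: eqVneq => [->|x0].
  by rewrite residue0 eqxx invr_ge0 exprn_ge0 ?ler0n.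
rewrite padic_zvalP // lef_pV2 ?posrE ?exprn_gt0 ?pQ_gt0 //.
by rewrite ler_eXn2l // ltr1n prime_gt1.
Qed.

Lemma padic_znormD x y :
  padic_znorm (x + y) <= Num.max (padic_znorm x) (padic_znorm y).
Proof.
case: (eqVneq x 0) => [->|x0].
  by rewrite add0r le_max lexx orbT.
case: (eqVneq y 0) => [->|y0]; first by rewrite addr0 le_max lexx.
wlog xy : x y x0 y0 / padic_znorm x <= padic_znorm y => [H|].
  by case/orP: (le_total (padic_znorm x) (padic_znorm y)) => h;
    [|rewrite addrC maxC]; apply: H.
rewrite (max_idPr xy); have yE : padic_znorm y = p%:R ^- padic_zval y.
  by rewrite /padic_znorm (negPf y0).
move: xy; rewrite yE !padic_znorm_le residueD => /eqP ->.
by rewrite add0n residue_modn padic_zvalP.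
Qed.

End PadicInt.

Definition padic (p : nat) (hp : prime p) : Type := {fraction padic_int hp}.

Section Padic.
Variables (p : nat) (hp : prime p).
Local Notation Zp := (padic_int hp).
Local Notation Qp := (padic hp).

HB.instance Definition _ := GRing.Field.copy Qp {fraction Zp}.

Implicit Types x y z : Qp.

(** [|a / b|_p = |a|_p / |b|_p]; the values are powers of [p] or 0, hence
    rational. *)
Definition padic_norm (x : Qp) : rat :=
  padic_znorm (repr x).1 / padic_znorm (repr x).2.

Definition padic_of_int (a : Zp) : Qp := FracField.tofrac a.
HB.instance Definition _ := GRing.RMorphism.copy padic_of_int (@FracField.tofrac Zp).

Lemma padic_of_int_eq0 a : (padic_of_int a == 0) = (a == 0).
Proof. exact: tofrac_eq0. Qed.

Lemma padic_fracE x : x = padic_of_int (repr x).1 / padic_of_int (repr x).2.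
Proof.
have b0 : padic_of_int (repr x).2 != 0 by rewrite padic_of_int_eq0 denom_ratioP.
apply: (mulIf b0); rewrite divfK // /padic_of_int.
rewrite -{1}(reprK (x : {fraction Zp})); move: (repr x) => r.
unlock FracField.tofrac; rewrite -[LHS]FracField.pi_mul.
apply/eqmodP; rewrite /= FracField.equivfE /FracField.mulf.
by rewrite !numden_Ratio ?mulf_neq0 ?oner_neq0 ?denom_ratioP // !mulr1 mulrC.
Qed.

Lemma padic_norm_frac (a b : Zp) : b != 0 ->
  padic_norm (padic_of_int a / padic_of_int b) = padic_znorm a / padic_znorm b.
Proof.
move=> b0; set x := padic_of_int a / padic_of_int b.
have := padic_fracE x; rewrite /padic_norm.
have := denom_ratioP (repr x); move: (repr x).1 (repr x).2 => n d d0 xE.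
have nz c : c != 0 -> padic_znorm c != 0 :> rat by rewrite padic_znorm_eq0.
apply/eqP; rewrite eqr_div ?nz // -!padic_znormM.
suff -> : n * b = a * d by [].
apply/eqP; rewrite -tofrac_eq !tofracM.
by rewrite -eqr_div ?tofrac_eq0 //; apply/eqP; rewrite -[LHS]xE.
Qed.

Variant padic_spec x : Prop :=
  PadicSpec a b of b != 0 & x = padic_of_int a / padic_of_int b.

Lemma padicP x : padic_spec x.
Proof.
by apply: (@PadicSpec _ (repr x).1 (repr x).2); [exact: denom_ratioP|exact: padic_fracE].
Qed.

Lemma padic_norm_of_int a : padic_norm (padic_of_int a) = padic_znorm a.
Proof.
have := @padic_norm_frac a 1 (oner_neq0 _); rewrite rmorph1 divr1 => ->.
suff -> : padic_znorm (1 : Zp) = 1 by rewrite divr1.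
have z1 : padic_znorm (1 : Zp) != 0 by rewrite padic_znorm_eq0 oner_neq0.
by apply: (mulIf z1); rewrite -padic_znormM mulr1 mul1r.
Qed.

Lemma padic_norm_ge0 x : 0 <= padic_norm x.
Proof. by rewrite divr_ge0 ?padic_znorm_ge0. Qed.

Lemma padic_norm0 : padic_norm 0 = 0.
Proof. by rewrite -[0](rmorph0 padic_of_int) padic_norm_of_int padic_znorm0. Qed.

Lemma padic_norm_eq0 x : (padic_norm x == 0) = (x == 0).
Proof.
case: (padicP x) => a b b0 ->; rewrite padic_norm_frac //.
by rewrite !mulf_eq0 !invr_eq0 !padic_znorm_eq0 !padic_of_int_eq0.
Qed.

Lemma padic_normM x y : padic_norm (x * y) = padic_norm x * padic_norm y.
Proof.
case: (padicP x) => a b b0 ->; case: (padicP y) => c d d0 ->.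
rewrite mulf_div -!rmorphM !padic_norm_frac ?mulf_neq0 // !padic_znormM.
by rewrite mulf_div.
Qed.

Lemma padic_normD x y :
  padic_norm (x + y) <= Num.max (padic_norm x) (padic_norm y).
Proof.
case: (padicP x) => a b b0 ->; case: (padicP y) => c d d0 ->.
have z0 e : e != 0 -> padic_znorm e != 0 :> rat by rewrite padic_znorm_eq0.
have z_gt0 : 0 < padic_znorm (b * d).
  by rewrite lt_neqAle eq_sym z0 ?padic_znorm_ge0 // mulf_neq0.
have -> : padic_of_int a / padic_of_int b = padic_of_int (a * d) / padic_of_int (b * d).
  by rewrite !rmorphM -mulf_div divff ?mulr1 ?padic_of_int_eq0.
have -> : padic_of_int c / padic_of_int d = padic_of_int (b * c) / padic_of_int (b * d).
  by rewrite !rmorphM -mulf_div divff ?mul1r ?padic_of_int_eq0.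
rewrite -mulrDl -rmorphD !padic_norm_frac ?mulf_neq0 //.
rewrite -maxr_pMl ?invr_ge0 ?padic_znorm_ge0 //.
by rewrite ler_pM2r ?invr_gt0 // padic_znormD.
Qed.

Lemma padic_normN x : padic_norm (- x) = padic_norm x.
Proof.
apply/eqP; rewrite -(@eqrXn2 _ 2) ?padic_norm_ge0 //.
by rewrite !expr2 -!padic_normM mulrNN.
Qed.

Lemma padic_norm_p : padic_norm p%:R = p%:R^-1.
Proof.
rewrite -(rmorph_nat padic_of_int) padic_norm_of_int.
have resp n : (p%:R : Zp) n = (p %% p ^ n)%N by rewrite residue_natr.
have r2 : (p%:R : Zp) 2 != 0%N.
  by rewrite resp modn_small -?lt0n ?prime_gt0 // -{1}(expn1 p) ltn_exp2l ?prime_gt1.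
have p0 : (p%:R : Zp) != 0.
  by apply: contra r2 => /eqP ->; rewrite residue0.
rewrite /padic_znorm (negPf p0); congr (_^-1).
suff -> : padic_zval (p%:R : Zp) = 1%N by rewrite expr1.
apply/eqP; rewrite eqn_leq -padic_zvalP // resp expn1 modnn eqxx andbT.
by rewrite leqNgt -padic_zvalP.
Qed.

Definition padic_dist x y : rat := padic_norm (x - y).

Lemma padic_distxx x : padic_dist x x = 0.
Proof. by rewrite /padic_dist subrr padic_norm0. Qed.
Lemma padic_dist_eq0 x y : padic_dist x y = 0 -> x = y.
Proof. by move/eqP; rewrite padic_norm_eq0 subr_eq0 => /eqP. Qed.
Lemma padic_dist_sym x y : padic_dist x y = padic_dist y x.
Proof. by rewrite /padic_dist -padic_normN opprB. Qed.
Lemma padic_dist_triangle y x z :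
  padic_dist x z <= padic_dist x y + padic_dist y z.
Proof.
rewrite /padic_dist -(subrKA y); apply: (le_trans (padic_normD _ _)).
by rewrite ge_max lerDl lerDr !padic_norm_ge0.
Qed.

(** The norm takes rational values, so the metric can be
    declared over [rat], once for all realTypes. *)
HB.instance Definition _ := isMetric.Build rat Qp
  padic_distxx padic_dist_eq0 padic_dist_sym padic_dist_triangle.
HB.instance Definition _ := isPointed.Build Qp 0.

Definition padic_borel : set (set Qp) := <<s [set A : set Qp | open A] >>.

Lemma padic_borel0 : padic_borel set0.
Proof. exact: sigma_algebra0. Qed.
Lemma padic_borelC A : padic_borel A -> padic_borel (~` A).
Proof. exact: sigma_algebraC. Qed.
Lemma padic_borel_bigcup (F : (set Qp)^nat) : (forall i, padic_borel (F i)) ->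
  padic_borel (\bigcup_i (F i)).
Proof. exact: sigma_algebra_bigcup. Qed.

Fact padic_display : measure_display.
Proof. exact: default_measure_display. Qed.
HB.instance Definition _ := isMeasurable.Build padic_display Qp
  padic_borel0 padic_borelC padic_borel_bigcup.

(** The fractional part: the [r = m / p ^ k] in [0, 1[ with [x - r] in Z_p. *)
Definition is_padic_frac x (r : rat) :=
  exists m k : nat, [/\ (m < p ^ k)%N, r = m%:R / p%:R ^+ k
    & padic_norm (x - m%:R / p%:R ^+ k) <= 1].

Definition padic_frac x : rat := xget 0 [set r | is_padic_frac x r].

Lemma residueB_eq0 (a b : Zp) k : ((a - b) k == 0%N) = (a k == b k).
Proof.
have ak : a k = (((a - b)%R k + b k) %% p ^ k)%N by rewrite -residueD subrK.
rewrite ak -[X in _ = (_ == X)](residue_modn b k).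
by rewrite -[X in (_ == X %% _)%N]add0n eqn_modDr mod0n residue_modn.
Qed.

Lemma padic_norm_pX k : padic_norm (p%:R ^+ k) = p%:R ^- k.
Proof.
elim: k => [|k IH].
  rewrite expr0 invr1 -(rmorph1 padic_of_int) padic_norm_of_int.
  have z1 : padic_znorm (1 : Zp) != 0 by rewrite padic_znorm_eq0 oner_neq0.
  by apply: (mulIf z1); rewrite -padic_znormM mulr1 mul1r.
by rewrite exprS padic_normM IH padic_norm_p exprS invfM.
Qed.

Lemma pX_neq0 k : (p%:R : Qp) ^+ k != 0.
Proof.
by rewrite -padic_norm_eq0 padic_norm_pX invr_eq0 expf_neq0 // gt_eqF // pQ_gt0.
Qed.

Let padic_of_int_pX k : p%:R ^+ k = padic_of_int (p ^ k)%:R.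
Proof. by rewrite rmorph_nat natrX. Qed.

Let znorm_pX k : padic_znorm ((p ^ k)%:R : Zp) = p%:R ^- k.
Proof. by rewrite -padic_norm_of_int -padic_of_int_pX padic_norm_pX. Qed.

Lemma padic_frac_ex x : exists r, is_padic_frac x r.
Proof.
case: (padicP x) => a b b0 ->; set k := padic_zval b.
set N := (k + k).+1; pose K := (k + k)%N.
have [bN_gt0 vbN] : (0 < b N)%N /\ logn p (b N) = k.
  by apply: logn_residue => //; rewrite ltnS leq_addr.
have pk_gt0 : (0 < p ^ k)%N by rewrite expn_gt0 prime_gt0.
have [c pc bNE] : exists2 c, coprime p c & b N = (c * p ^ k)%N.
  by case: (pfactor_coprime hp bN_gt0) => c; rewrite vbN; exists c.
have c_gt0 : (0 < c)%N by move: bN_gt0; rewrite bNE muln_gt0 => /andP[].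
case: (@egcdnP c (p ^ k) c_gt0) => u v uv _.
have cop : gcdn c (p ^ k) = 1%N by apply/eqP; rewrite -/(coprime _ _) coprime_sym coprimeXl.
rewrite cop in uv.
pose m := ((a N * u) %% p ^ k)%N.
exists (m%:R / p%:R ^+ k), m, k; split=> //; first by rewrite ltn_mod.
have pX0 : ((p ^ k)%:R : Zp) != 0 by rewrite -padic_of_int_eq0 -padic_of_int_pX pX_neq0.
have -> : padic_of_int a / padic_of_int b - m%:R / p%:R ^+ k =
    padic_of_int (a * (p ^ k)%:R - m%:R * b) / padic_of_int (b * (p ^ k)%:R).
  rewrite rmorphB !rmorphM /= -padic_of_int_pX rmorph_nat mulrBl; congr (_ - _).
    by rewrite -mulf_div divff ?mulr1 // pX_neq0.
  by rewrite [padic_of_int b * _]mulrC -mulf_div divff ?mulr1 // padic_of_int_eq0.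
rewrite padic_norm_frac ?mulf_neq0 // padic_znormM znorm_pX.
have -> : padic_znorm b = p%:R ^- k by rewrite /padic_znorm (negPf b0).
rewrite -invfM -exprD ler_pdivrMr ?mul1r ?invr_gt0 ?exprn_gt0 ?pQ_gt0 //.
rewrite padic_znorm_le residueB_eq0 !residueM !residue_natr.
rewrite modnMmr modnMml (residue_mod a (leqnSn _)) (residue_mod b (leqnSn _)).
rewrite modnMml modnMmr -/N bNE mulnA expnD -!muln_modl ?pk_gt0 // eqn_pmul2r //.
by rewrite /m modnMml -mulnA uv mulnDr muln1 mulnA modnMDl.
Qed.

Lemma padic_frac_uniq x r s : is_padic_frac x r -> is_padic_frac x s -> r = s.
Proof.
move=> [m [k [mk -> xm]]] [n [l [nl -> xn]]].
have pk_gt0 j : (0 < p ^ j)%N by rewrite expn_gt0 prime_gt0.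
have pQ0 j : (p%:R : rat) ^+ j != 0 by rewrite expf_neq0 // gt_eqF // pQ_gt0.
have pX0 j : ((p ^ j)%:R : Zp) != 0 by rewrite -padic_of_int_eq0 -padic_of_int_pX pX_neq0.
suff H : (m * p ^ l = n * p ^ k)%N.
  by apply/eqP; rewrite eqr_div // -!natrX -!natrM H.
have : padic_norm (n%:R / p%:R ^+ l - m%:R / p%:R ^+ k) <= 1.
  rewrite -(subrKA x) (le_trans (padic_normD _ _)) // ge_max xm andbT.
  by rewrite -padic_normN opprB.
have -> : n%:R / p%:R ^+ l - m%:R / p%:R ^+ k =
    padic_of_int ((n * p ^ k)%:R - (m * p ^ l)%:R) / padic_of_int (p ^ (k + l))%:R.
  rewrite rmorphB /= !rmorph_nat !natrM !natrX mulrBl exprD; congr (_ - _).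
    by rewrite [_ ^+ k * _ ^+ l]mulrC -mulf_div divff ?mulr1 // pX_neq0.
  by rewrite -mulf_div divff ?mulr1 // pX_neq0.
rewrite padic_norm_frac // znorm_pX.
rewrite ler_pdivrMr ?mul1r ?invr_gt0 ?exprn_gt0 ?pQ_gt0 //.
rewrite padic_znorm_le residueB_eq0 !residue_natr expnD.
rewrite !modn_small; first by move/eqP.
  by rewrite ltn_pmul2r.
by rewrite mulnC ltn_pmul2l.
Qed.

Lemma padic_fracP x : is_padic_frac x (padic_frac x).
Proof. by case: (padic_frac_ex x) => r xr; exact: (xgetPex 0 (ex_intro _ r xr)). Qed.

Lemma padic_frac_eq x r : is_padic_frac x r -> padic_frac x = r.
Proof. exact: padic_frac_uniq (padic_fracP x). Qed.

End Padic.

Section Fourier.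
Variables (R : realType) (p : nat) (hp : prime p).
Local Notation Qp := (padic hp).
Local Open Scope complex_scope.

Definition expi (theta : R) : R[i] := cos theta +i* sin theta.

Definition padic_abs (x : Qp) : R := ratr (padic_norm x).

Definition padic_char (y x : Qp) : R[i] :=
  expi (2 * pi * ratr (padic_frac (x * y))).

Definition cintegrable d (T : measurableType d) (mu : {measure set T -> \bar R})
    (f : T -> R[i]) : Prop :=
  mu.-integrable setT (EFin \o (fun x => complex.Re (f x))) /\
  mu.-integrable setT (EFin \o (fun x => complex.Im (f x))).

Definition cintegral d (T : measurableType d) (mu : {measure set T -> \bar R})
    (f : T -> R[i]) : R[i] :=
  (\int[mu]_x complex.Re (f x))%R +i* (\int[mu]_x complex.Im (f x))%R.

Definition padic_fourier (mu : {measure set Qp -> \bar R}) (y : Qp) : R[i] :=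
  cintegral mu (fun x => padic_char y (- x)).

(** A translation-invariant Borel measure giving mass 1 to Z_p: finite on
    compact sets and positive on nonempty open sets, as Z_p is covered by p^k
    translates of the ball [p^k Z_p]. *)
Definition padic_haar (mu : {measure set Qp -> \bar R}) : Prop :=
  (forall (a : Qp) (A : set Qp), measurable A -> mu [set a + x | x in A] = mu A)
  /\ mu [set x | padic_abs x <= 1] = 1%E.

(** Only the restriction of [rho] to [0, +oo[ matters. *)
Definition convolution_semigroup (rho : R -> probability Qp R) : Prop :=
  [/\ forall A, measurable A -> rho 0 A = \d_(0 : Qp) A,
      forall s t, 0 <= s -> 0 <= t -> forall A, measurable A ->
        rho (s + t) A = pushforward (rho s \x rho t)%E (fun z => z.1 + z.2) A
    & forall g : Qp -> R, continuous g -> (exists M, forall x, `|g x| <= M) ->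
        (\int[rho t]_x g x)%R @[t --> 0^'+] --> g 0].

Definition stable_integrand (C gamma t : R) (x y : Qp) : R[i] :=
  padic_char y x * (expR (- (C * t * padic_abs y `^ gamma)))%:C.

End Fourier.

(* Main.v *)
Require Import Defs.
From HB Require Import structures.
From mathcomp Require Import all_boot all_order all_algebra.
From mathcomp Require Import complex.
From mathcomp Require Import all_classical all_reals all_analysis.
From mathcomp Require Import measurable_realfun.
From mathcomp Require Import zify ring lra.

Set Implicit Arguments.
Unset Strict Implicit.
Unset Printing Implicit Defensive.

Import Order.TTheory GRing.Theory Num.Theory.
Import numFieldNormedType.Exports.

Local Open Scope classical_set_scope.
Local Open Scope ring_scope.
Local Open Scope complex_scope.

(** The symbol [phi y = exp (- C t |y|_p ^ gamma)] is a decreasing function of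
    the norm, so summation by parts writes it as a positive mixture of
    indicators of balls: with [w_k = phi (p^k) - phi (p^(k+1)) >= 0],
    phi is the sum over all integers [k] of [w_k 1(|y|_p <= p^k)]. The Fourier
    transform of the indicator of a ball is explicit, since a character is
    either trivial on the ball or has integral 0 there
    ([padic_char_integral]): the ball of radius [p^k] is sent to [p^k] times
    the indicator of the ball of radius [p^-k]. Transforming termwise
    ([radial_fourier]), the function of the theorem is

      [f x] = sum over [k] of [w_k p^k 1(|x|_p <= p^-k)],

    which is again a positive mixture of balls. It is visibly real and
    nonnegative, it is continuous because the [w_k p^k] are summable (phi decays
    faster than any power of the norm along [p^k]), and the same termwise
    computation applied to [f] gives back phi. So [f] times Haar measure and
    [rho t] have the same Fourier transform.

    Two such measures agree on every ball: the mean of the first [p^N]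
    powers of a root of unity of [p]-power order is 1 or, for [N] large, 0, so
    that the indicator of a ball is a bounded pointwise limit of finite
    averages of characters ([padic_char_mean_cvg]), and dominated convergence
    recovers the mass of the ball from the Fourier transform
    ([ball_inversion]). Balls form a pi-system generating the Borel sets
    ([measurable_pballs]), so the two measures agree everywhere
    ([density_of_pballs]). *)

(** * Balls *)
Section PadicBalls.
Variables (p : nat) (hp : prime p).
Local Notation Qp := (padic hp).
Implicit Types (x y : Qp) (k l : int).

(** The ball is indexed by the exponent of its radius, so that it is the
    subgroup [p^-k Z_p]; other closed balls appear as its cosets. *)
Definition pball k : set Qp := [set x | padic_norm x <= p%:R ^ k].

Lemma pV_gt0 (F : numFieldType) k : 0 < (p%:R : F) ^ k.
Proof. by rewrite exprz_gt0 // ltr0n prime_gt0. Qed.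

Lemma pF_gt1 (F : numFieldType) : 1 < (p%:R : F).
Proof. by rewrite ltr1n prime_gt1. Qed.

Lemma pQ_neq0 : (p%:R : Qp) != 0.
Proof. by have := pX_neq0 hp 1; rewrite expr1. Qed.

Lemma padic_norm1 : padic_norm (1 : Qp) = 1.
Proof. by have := padic_norm_pX hp 0; rewrite expr0 invr1. Qed.

Lemma padic_normV x : padic_norm x^-1 = (padic_norm x)^-1.
Proof.
have [->|x0] := eqVneq x 0; first by rewrite invr0 padic_norm0 invr0.
have nx : padic_norm x != 0 by rewrite padic_norm_eq0.
by apply: (mulfI nx); rewrite -padic_normM !divff // padic_norm1.
Qed.

Lemma padic_norm_pz k : padic_norm ((p%:R : Qp) ^ k) = p%:R ^ (- k).
Proof.
case: k => n; first by rewrite -exprnP padic_norm_pX exprnN.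
by rewrite NegzE -exprnN padic_normV padic_norm_pX invrK opprK.
Qed.

Lemma pballD k x y : pball k x -> pball k y -> pball k (x + y).
Proof.
rewrite /pball /= => xk yk.
by rewrite (le_trans (padic_normD _ _)) // ge_max xk.
Qed.

Lemma pballN k x : pball k (- x) = pball k x.
Proof. by rewrite /pball /= padic_normN. Qed.

Lemma pballB k x y : pball k x -> pball k y -> pball k (x - y).
Proof. by move=> xk yk; apply: pballD; rewrite ?pballN. Qed.

Lemma pball0 k : pball k 0.
Proof. by rewrite /pball /= padic_norm0 ltW // pV_gt0. Qed.

Lemma pballDl k x y : pball k x -> pball k (x + y) = pball k y.
Proof.
move=> xk; rewrite propeqE; split=> [xyk|]; last exact: pballD.
by rewrite -(addKr x y) addrC; apply: pballB.
Qed.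

Lemma ler_pz k l : ((p%:R : rat) ^ k <= p%:R ^ l) = (k <= l).
Proof. by rewrite ler_eXz2l // pF_gt1. Qed.

Lemma pball_le k l x : k <= l -> pball k x -> pball l x.
Proof. by rewrite /pball /= => kl xk; rewrite (le_trans xk) // ler_pz. Qed.

Lemma pball_pz k l : pball k ((p%:R : Qp) ^ l) = (- l <= k) :> Prop.
Proof. by rewrite /pball /= padic_norm_pz ler_pz. Qed.

Lemma pballM k l x y : pball k x -> pball l y -> pball (k + l) (x * y).
Proof.
rewrite /pball /= => xk yl; rewrite padic_normM expfzDr ?gt_eqF ?pQ_gt0 //.
by rewrite ler_pM ?padic_norm_ge0.
Qed.

Lemma pball_scale k l x : pball k (x * p%:R ^ l) = pball (k + l) x.
Proof.
rewrite /pball /= padic_normM padic_norm_pz -invr_expz ler_pdivrMr ?pV_gt0 //.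
by rewrite -expfzDr // gt_eqF // pQ_gt0.
Qed.

Lemma padic_norm_pz_ex x : x != 0 -> exists k, padic_norm x = p%:R ^ k.
Proof.
case: (padicP x) => a b b0 -> ab0.
have a0 : a != 0.
  by apply: contraNneq ab0 => ->; rewrite rmorph0 mul0r.
rewrite padic_norm_frac // /padic_znorm (negPf a0) (negPf b0).
exists ((padic_zval b)%:Z - (padic_zval a)%:Z).
by rewrite expfzDr ?gt_eqF ?pQ_gt0 // invrK mulrC exprnN.
Qed.

Lemma pball_ex x : exists n : nat, pball n%:Z x.
Proof.
have [->|/padic_norm_pz_ex[k xk]] := eqVneq x 0; first by exists 0%N; apply: pball0.
by exists `|k|%N; rewrite /pball /= xk ler_pz; case: k {xk} => // n.
Qed.

Lemma pball_nat n (m : nat) : pball (- n%:Z) (m%:R : Qp) -> (p ^ n %| m)%N.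
Proof.
rewrite /pball /= -(rmorph_nat (@padic_of_int p hp)) padic_norm_of_int.
by rewrite -exprnN padic_znorm_le residue_natr.
Qed.

(** * Fractional parts *)

(** In the definition of the fractional part the denominator [p^l] is
    unconstrained. Its exponent can be taken equal to that of the radius: if
    [l] is larger, then [m / p^l] lies in the ball too, which forces
    [p^(l-n)] to divide [m]. *)
Lemma padic_frac_pball (n : nat) x : pball n%:Z x ->
  exists m : nat, [/\ (m < p ^ n)%N, padic_frac x = m%:R / p%:R ^+ n
    & pball 0 (x - m%:R / p%:R ^+ n)].
Proof.
move=> xn; have [m [l [ml -> xm]]] := padic_fracP x.
have pQ j : (p%:R : Qp) ^+ j != 0 := pX_neq0 hp j.
have pq j : (p%:R : rat) ^+ j != 0 by rewrite expf_neq0 // gt_eqF // pQ_gt0.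
have [ln|nl] := leqP l n.
  have E (F : fieldType) : (p%:R : F) ^+ l != 0 -> (p%:R : F) ^+ n != 0 ->
      m%:R / p%:R ^+ l = (m * p ^ (n - l))%:R / p%:R ^+ n :> F.
    move=> l0 n0; apply/eqP; rewrite eqr_div //.
    by rewrite natrM natrX -mulrA -exprD subnK.
  exists (m * p ^ (n - l))%N; split.
  - by rewrite -(subnK ln) addnK expnD mulnC ltn_pmul2l // expn_gt0 prime_gt0.
  - exact: E.
  - by rewrite /pball /= -E // expr0z.
have m_n : pball n%:Z (m%:R / p%:R ^+ l : Qp).
  have -> : m%:R / p%:R ^+ l = x - (x - m%:R / p%:R ^+ l) :> Qp by rewrite subKr.
  apply: pballB => //; apply: (@pball_le 0) => //.
have : pball (- (l - n)%N%:Z) (m%:R : Qp).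
  move: m_n; rewrite exprnN pball_scale.
  by rewrite -subzn 1?ltnW // opprB.
move/pball_nat/dvdnP => [m' mE].
have pln : (0 < p ^ (l - n))%N by rewrite expn_gt0 prime_gt0.
have E (F : fieldType) : (p%:R : F) ^+ l != 0 -> (p%:R : F) ^+ n != 0 ->
    m%:R / p%:R ^+ l = m'%:R / p%:R ^+ n :> F.
  move=> l0 n0; apply/eqP; rewrite eqr_div // mE natrM natrX -mulrA -exprD.
  by rewrite subnK // ltnW.
exists m'; split.
- by move: ml; rewrite mE -{2}(subnK (ltnW nl)) expnD mulnC ltn_pmul2l.
- exact: E.
- by rewrite /pball /= -E // expr0z.
Qed.

Lemma padic_frac_eq0 x : padic_frac x = 0 <-> pball 0 x.
Proof.
split=> [|x0].
  have [m [l [ml -> xm]]] := padic_fracP x.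
  move/eqP; rewrite mulf_eq0 invr_eq0 [_ ^+ l == 0]expf_eq0.
  rewrite [p%:R == 0]gt_eqF ?pQ_gt0 // andbF orbF pnatr_eq0 => /eqP m0.
  by move: xm; rewrite m0 mul0r subr0 /pball /= expr0z.
apply: padic_frac_eq; exists 0%N, 0%N.
by rewrite !mul0r subr0; move: x0; rewrite /pball /= expr0z.
Qed.

Lemma padic_frac_ge0 x : 0 <= padic_frac x.
Proof.
have [m [l [_ -> _]]] := padic_fracP x.
by rewrite divr_ge0 // exprn_ge0.
Qed.

Lemma padic_frac_lt1 x : padic_frac x < 1.
Proof.
have [m [l [ml -> _]]] := padic_fracP x.
by rewrite ltr_pdivrMr ?exprn_gt0 ?pQ_gt0 // mul1r -natrX ltr_nat.
Qed.

(** Fractional parts add modulo 1; this is what makes the characters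
    multiplicative. *)
Lemma padic_fracD x y : exists n : nat,
  padic_frac x + padic_frac y = padic_frac (x + y) + n%:R.
Proof.
have [i xi] := pball_ex x; have [j yj] := pball_ex y.
pose n := maxn i j.
have xn : pball n%:Z x by apply: pball_le xi; rewrite lez_nat leq_maxl.
have yn : pball n%:Z y by apply: pball_le yj; rewrite lez_nat leq_maxr.
have [a [_ -> xa]] := padic_frac_pball xn.
have [b [_ -> yb]] := padic_frac_pball yn.
have pn : (p%:R : rat) ^+ n != 0 by rewrite expf_neq0 // gt_eqF // pQ_gt0.
pose q := ((a + b) %/ p ^ n)%N; pose r := ((a + b) %% p ^ n)%N.
have abE : (a + b = q * p ^ n + r)%N by rewrite /q /r -divn_eq.
have -> : padic_frac (x + y) = r%:R / p%:R ^+ n.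
  apply: padic_frac_eq; exists r, n; split=> //.
    by rewrite /r ltn_mod expn_gt0 prime_gt0.
  have -> : x + y - r%:R / p%:R ^+ n
      = (x - a%:R / p%:R ^+ n) + (y - b%:R / p%:R ^+ n) + q%:R.
    have -> : r%:R = a%:R + b%:R - q%:R * p%:R ^+ n :> Qp.
      by rewrite -natrD abE natrD natrM natrX addrAC subrr add0r.
    rewrite mulrBl mulfK ?pX_neq0 // mulrDl; ring.
  have : pball 0 (x - a%:R / p%:R ^+ n + (y - b%:R / p%:R ^+ n) + q%:R).
    apply: pballD; first exact: pballD.
    rewrite /pball /= expr0z -(rmorph_nat (@padic_of_int p hp)).
    by rewrite padic_norm_of_int (padic_znorm_le _ 0) residue_natr expn0 modn1.
  by rewrite /pball /= expr0z.
exists q; rewrite -mulrDl -natrD abE natrD natrM natrX mulrDl mulfK //.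
by rewrite addrC.
Qed.

(** * Topology and Borel sets *)

Lemma open_pballP (A : set Qp) :
  open A <-> forall x, A x -> exists k, forall y, pball k y -> A (x + y).
Proof.
rewrite openE; split=> [oA x /oA|H x /H[k xk]].
  rewrite /interior nbhs_ballP => -[e /= e0 xe].
  have [n ne] : exists n : nat, (p%:R : rat) ^- n < e.
    have [n ne] : exists n : nat, e^-1 < n%:R.
      exists (Num.truncn e^-1).+1; exact: truncnS_gt.
    exists n; rewrite invf_plt ?posrE ?exprn_gt0 ?pQ_gt0 //.
    rewrite (lt_trans ne) // -natrX ltr_nat ltn_expl // prime_gt1 //.
  exists (- n%:Z) => y yn; apply: xe.
  rewrite /ball /= /padic_dist opprD addNKr padic_normN.
  by rewrite (le_lt_trans yn) // -exprnN.
rewrite /interior nbhs_ballP; exists (p%:R ^ k); first exact: pV_gt0.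
move=> y; rewrite /ball /= -/(ball _ _ _) => xy.
rewrite -(subrK x y) addrC; apply: xk.
move: xy; rewrite /pball /= /ball /= /padic_dist -padic_normN opprB.
exact: ltW.
Qed.

(** Characters are uniformly locally constant, and the preimage of an arbitrary
    set under such a function is open. *)
Lemma locally_constant_preimage_open (T : Type) (f : Qp -> T) k (A : set T) :
  (forall x y, pball k y -> f (x + y) = f x) -> open (f @^-1` A).
Proof.
by move=> fk; apply/open_pballP => x Ax; exists k => y yk; rewrite /= fk.
Qed.

Lemma open_measurable_padic (A : set Qp) : open A -> measurable A.
Proof. exact: sub_sigma_algebra. Qed.

Lemma measurable_locally_constant d (T : measurableType d) (f : Qp -> T) k :
  (forall x y, pball k y -> f (x + y) = f x) -> measurable_fun setT f.
Proof.
move=> fk _ A mA; rewrite setTI; apply: open_measurable_padic.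
exact: locally_constant_preimage_open fk.
Qed.

Lemma open_pball k a : open [set x | pball k (x - a)].
Proof.
apply/open_pballP => x xk; exists k => y yk /=.
by rewrite addrAC; apply: pballD.
Qed.

Lemma measurable_pball k a : measurable [set x | pball k (x - a)].
Proof. by apply: open_measurable_padic; apply: open_pball. Qed.

Lemma measurable_pball0 k : measurable (pball k).
Proof.
rewrite (_ : pball k = [set x | pball k (x - 0)]); first exact: measurable_pball.
by apply/seteqP; split=> x; rewrite /= subr0.
Qed.

Lemma measurable_translate (a : Qp) : measurable_fun setT (+%R a).
Proof.
apply: (measurability [set A : set Qp | open A]) => //= _ [A oA <-].
rewrite setTI.
apply: open_measurable_padic; apply/open_pballP => x /= Ax.
have /open_pballP/(_ _ Ax)[k xk] := oA.
by exists k => y yk /=; rewrite addrA; apply: xk.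
Qed.

End PadicBalls.

(** * Haar measure of balls *)
Section HaarBalls.
Variables (p : nat) (hp : prime p).
Local Notation Qp := (padic hp).
Implicit Types (x y : Qp) (k l : int).

(** The empty set is included to make the family a pi-system: two balls are
    nested or disjoint. *)
Definition pballs : set (set Qp) :=
  [set A | A = set0 \/ exists k a, A = [set x | pball k (x - a)]].

Lemma pballs_setI : setI_closed pballs.
Proof.
have main k l a b : k <= l -> pballs ([set x : Qp | pball k (x - a)] `&`
    [set x | pball l (x - b)]).
  move=> kl; have [ab|ab] := pselect (pball l (a - b)).
    right; exists k, a; apply/seteqP; split=> x /= => [[]//|xa].
    split=> //; rewrite -(subrKA a) addrC pballDl //.
    exact: pball_le kl xa.
  left; apply/seteqP; split=> // x /= [xa xb]; apply: ab.
  rewrite -(subrKA x); apply: pballD => //.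
  by rewrite -pballN opprB; apply: pball_le kl xa.
move=> A B [->|[k [a ->]]]; first by left; rewrite set0I.
move=> [->|[l [b ->]]]; first by left; rewrite setI0.
by have [kl|/ltW kl] := leP k l; [|rewrite setIC]; apply: main.
Qed.

(** Every ball is centered at a point of the countable set [Z[1/p]], namely at
    a rescaled fractional part; this gives second countability. *)
Lemma pball_rational_center k x : exists m l : nat,
  pball k (x - m%:R / p%:R ^+ l * p%:R ^ (- k)).
Proof.
have [m [l [_ _ xm]]] := padic_fracP (x * p%:R ^ k).
exists m, l; have pk : (p%:R : Qp) ^ k != 0 by rewrite expfz_neq0 // pQ_neq0.
have -> : x - m%:R / p%:R ^+ l * p%:R ^ (- k)
    = (x * p%:R ^ k - m%:R / p%:R ^+ l) * p%:R ^ (- k).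
  by rewrite mulrBl -(mulrA x) -expfzDr ?pQ_neq0 // subrr expr0z mulr1.
by rewrite pball_scale subrr /pball /= expr0z.
Qed.

(** The union is indexed by all balls with a center in [Z[1/p]], those which are
    not contained in the open set being replaced by the empty set. *)
Lemma open_bigcup_pballs (A : set Qp) : open A ->
  exists F : nat * nat * int -> set Qp,
    (forall i, pballs (F i)) /\ A = \bigcup_i F i.
Proof.
move=> /open_pballP oA.
pose c (i : nat * nat * int) : Qp := i.1.1%:R / p%:R ^+ i.1.2 * p%:R ^ (- i.2).
pose B i := [set x : Qp | pball i.2 (x - c i)].
exists (fun i => if pselect (B i `<=` A) then B i else set0); split.
  by move=> i; case: pselect => BA; [right; exists i.2, (c i)|left].
apply/seteqP; split=> x /=; last by case=> i _; case: pselect => // BA /BA.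
move=> /[dup] Ax /oA[k xk]; have [m [l xml]] := pball_rational_center k x.
exists (m, l, k) => //; case: pselect => //; case=> y; rewrite /B /= => yml.
rewrite -(subrK x y) addrC; apply: xk; rewrite -(subrKA (c (m, l, k))).
by apply: pballD => //; rewrite -pballN opprB.
Qed.

Lemma measurable_pballs : @measurable _ Qp = <<s pballs >>.
Proof.
apply/seteqP; split.
- apply: smallest_sub; first exact: smallest_sigma_algebra.
  move=> A /= /open_bigcup_pballs[F [Fb ->]].
  apply: (@countable_bigcupT_measurable _ (g_sigma_algebraType pballs)) => //.
  by move=> i; apply: sub_sigma_algebra.
- apply: smallest_sub; first exact: sigma_algebra_measurable.
  by move=> A [->|[k [a ->]]]; [exact: measurable0|exact: measurable_pball].
Qed.

Lemma bigcup_pball : \bigcup_n pball (n%:Z) = [set: Qp].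
Proof.
by apply/seteqP; split=> // x _; have [n xn] := pball_ex x; exists n.
Qed.

Variables (R : realType) (haar : {measure set Qp -> \bar R}).
Hypothesis hhaar : padic_haar haar.

Lemma haar_translate a k : haar [set x | pball k (x - a)] = haar (pball k).
Proof.
have [H _] := hhaar; rewrite -(H a _ (measurable_pball0 k)).
congr (haar _); apply/seteqP; split=> x /=.
  by move=> xa; exists (x - a) => //; rewrite addrC subrK.
by case=> y yk <-; rewrite addrC addKr.
Qed.

(** The ball of radius [p^(k+1)] consists of [p] cosets of the one of radius
    [p^k], told apart by the leading digit, which is read off from a fractional
    part. *)
Lemma pball_coset_frac k (j : nat) x : (j < p)%N ->
  pball k (x - j%:R * p%:R ^ (- (k + 1))) <->
  pball (k + 1) x /\ padic_frac (x * p%:R ^ k) = j%:R / p%:R.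
Proof.
move=> jp; have -> : pball k (x - j%:R * p%:R ^ (- (k + 1))) =
    pball 0 (x * p%:R ^ k - j%:R / p%:R ^+ 1).
  rewrite -[in LHS](add0r k) -pball_scale mulrBl; congr (pball 0 (_ - _)).
  rewrite -mulrA -expfzDr ?pQ_neq0 //.
  by rewrite (_ : - (0 + k + 1) + k = -1) ?exprN1 ?expr1 //; ring.
rewrite (addrC k) -pball_scale; split=> [xj|[/(@padic_frac_pball _ _ 1%N)]]; last first.
  move=> [m [mp -> xm] mj]; suff <- : m = j by [].
  move/divIf : mj => /(_ _)/eqP; rewrite eqr_nat => /(_ _)/eqP; apply.
  by rewrite gt_eqF // pQ_gt0.
split; last first.
  rewrite -(expr1 (p%:R : rat)); apply: padic_frac_eq; exists j, 1%N.
  by rewrite expn1; split=> //; move: xj; rewrite /pball /= expr0z.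
rewrite -(subrK (j%:R / p%:R ^+ 1) (_ * _)).
apply: pballD; first exact: pball_le xj.
rewrite expr1 -[_^-1]exprN1 pball_scale subrr.
rewrite /pball /= -(rmorph_nat (@padic_of_int p hp)) padic_norm_of_int.
by rewrite expr0z (padic_znorm_le _ 0) residue_natr expn0 modn1.
Qed.

Lemma pball_cosets k : pball (k + 1) =
  \big[setU/set0]_(j < p) [set x : Qp | pball k (x - j%:R * p%:R ^ (- (k + 1)))].
Proof.
rewrite -(bigcup_mkord _ (fun j => [set x | pball k (x - j%:R * p%:R ^ (- (k + 1)))])).
apply/seteqP; split=> x.
  move=> xk; have : pball (1 + k) x by rewrite addrC.
  rewrite -pball_scale.
  move=> /(@padic_frac_pball _ _ 1%N)[m [mp xm _]]; rewrite expn1 in mp.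
  exists m => //; apply: (pball_coset_frac k x mp).2.
  by split; rewrite // xm expr1.
by case=> j /= jp /(pball_coset_frac _ _ jp)[].
Qed.

Lemma haar_pballS k : haar (pball (k + 1)) = (p%:R%:E * haar (pball k))%E.
Proof.
rewrite pball_cosets measure_bigsetU_ord => [|i|i j _ _ [x [/= xi xj]]].
- rewrite (eq_bigr (fun=> haar (pball k))) => [|i _]; last exact: haar_translate.
  have := measure_ge0 haar (pball k); move: (haar _) => e e0.
  elim: p => [|n IH]; first by rewrite big_ord0 mul0e.
  by rewrite big_ord_recr /= IH -natr1 EFinD ge0_muleDl ?lee_fin // mul1e.
- exact: measurable_pball.
- have [_ fi] := (pball_coset_frac _ _ (ltn_ord i)).1 xi.
  have [_] := (pball_coset_frac _ _ (ltn_ord j)).1 xj; rewrite fi.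
  move/divIf => /(_ _)/eqP; rewrite eqr_nat => /(_ _)/eqP ij.
  apply/val_inj/ij; by rewrite gt_eqF // pQ_gt0.
Qed.

(** Translation invariance multiplies the mass by [p] from one radius to the
    next; the normalization on [Z_p] then determines it in both directions. *)
Lemma haar_pball k : haar (pball k) = (p%:R ^ k)%:E.
Proof.
have p0 : (p%:R : R) != 0 by rewrite gt_eqF // ltr0n prime_gt0.
have h0 : haar (pball 0) = 1%E.
  have [_ <-] := hhaar; congr (haar _); apply/seteqP.
  by split=> x; rewrite /pball /= /padic_abs expr0z -(ler_rat R) rmorph1.
elim/int_rec: k => [|n IH|n IH]; first by rewrite h0 expr0z.
- by rewrite -[in pball _]addn1 PoszD haar_pballS IH -EFinM -exprSz.
- have := haar_pballS (- n.+1%:Z).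
  rewrite (_ : - n.+1%:Z + 1 = - n%:Z) ?IH; last by rewrite -addn1 PoszD; ring.
  move=> /(congr1 (fun e => (p%:R^-1)%:E * e)%E).
  rewrite muleA -!EFinM mulVf // mul1e => <-; congr EFin.
  by rewrite -[in RHS]addn1 PoszD opprD expfzDr // mulrC exprN1.
Qed.

End HaarBalls.

(** * Characters *)
Section Characters.
Variables (R : realType) (p : nat) (hp : prime p).
Local Notation Qp := (padic hp).
Implicit Types (x y z : Qp) (k l : int).
Local Notation chi := (@padic_char R p hp).

Lemma expiD (a b : R) : expi (a + b) = expi a * expi b.
Proof.
rewrite /expi cosD sinD; apply/eqP; rewrite eq_complex /=.
by rewrite eqxx addrC eqxx.
Qed.

Lemma expi0 : expi (0 : R) = 1.
Proof. by rewrite /expi cos0 sin0. Qed.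

Lemma expi_2piD (a b : R) :
  expi (2 * pi * (a + b)) = expi (2 * pi * a) * expi (2 * pi * b).
Proof. by rewrite (mulrDr (2 * pi)) expiD. Qed.

Lemma expi_2pi_nat n : expi (2 * pi * n%:R : R) = 1.
Proof.
elim: n => [|n IH]; first by rewrite mulr0 expi0.
rewrite -(natr1 n) expi_2piD IH mul1r mulr1 mulr_natl /expi cos2pi.
by rewrite mulr2n sinDpi sinpi oppr0.
Qed.

Lemma expi_2pi_neq1 (r : R) : 0 < r -> r < 1 -> expi (2 * pi * r) != 1.
Proof.
move=> r0 r1; have pi0 := pi_gt0 R.
have s0 : 0 < sin (pi * r).
  by rewrite sin_gt0_pi // mulr_gt0 //= gtr_pMr.
apply/eqP => /(congr1 (@complex.Re R)) /= /eqP.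
rewrite -mulrA mulr_natl cos_mulr2n cos2sin2 => /eqP.
have := exprn_gt0 2 s0; lra.
Qed.

Lemma padic_charD y x z : chi y (x + z) = chi y x * chi y z.
Proof.
have [n nE] := padic_fracD (x * y) (z * y).
rewrite /padic_char -expi_2piD -rmorphD /= nE rmorphD /= expi_2piD.
by rewrite ratr_nat expi_2pi_nat mulr1 (mulrDl x).
Qed.

(** The duality pairing is symmetric, so that a statement about the Fourier
    transform in one variable also applies to the inverse transform. *)
Lemma padic_charC y x : chi y x = chi x y.
Proof. by rewrite /padic_char (mulrC x). Qed.

Lemma padic_char_eq1 y x : chi y x = 1 <-> pball 0 (x * y).
Proof.
rewrite -padic_frac_eq0 /padic_char; split=> [/eqP|->]; last first.
  by rewrite rmorph0 mulr0 expi0.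
apply: contraTeq => f0; apply: expi_2pi_neq1.
  by rewrite ltr0q lt_neqAle eq_sym f0 padic_frac_ge0.
by rewrite -(rmorph1 (@ratr R)) ltr_rat padic_frac_lt1.
Qed.

Lemma padic_char0 y : chi y 0 = 1.
Proof. by apply/padic_char_eq1; rewrite mul0r; apply: pball0. Qed.

Lemma padic_char_mulrn y x n : chi y (x *+ n) = chi y x ^+ n.
Proof.
elim: n => [|n IH]; first by rewrite mulr0n padic_char0.
by rewrite mulrS padic_charD IH exprS.
Qed.

Lemma padic_char_norm y x :
  complex.Re (chi y x) ^+ 2 + complex.Im (chi y x) ^+ 2 = 1.
Proof. exact: cos2Dsin2. Qed.

Lemma padic_charN y x : chi y (- x) = (chi y x)^*%C.
Proof.
have u0 : chi y x != 0.
  apply/eqP => u0; have := padic_charD y x (- x).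
  by rewrite subrr padic_char0 u0 mul0r => /eqP; rewrite oner_eq0.
apply: (mulfI u0); rewrite -padic_charD subrr padic_char0.
have := padic_char_norm y x; case: (chi y x) => a b /= ab.
apply/eqP; rewrite eq_complex /= mulrN opprK -!expr2 ab eqxx /=.
by rewrite mulrN mulrC addrC subrr.
Qed.

Lemma Re_padic_char_le1 y x : `|complex.Re (chi y x)| <= 1.
Proof. exact: cos_max. Qed.

Lemma Im_padic_char_le1 y x : `|complex.Im (chi y x)| <= 1.
Proof. exact: sin_max. Qed.

Lemma padic_char_locally_constant y : exists k,
  forall x z, pball k z -> chi y (x + z) = chi y x.
Proof.
have [n yn] := pball_ex y; exists (- n%:Z) => x z zn.
rewrite padic_charD (_ : chi y z = 1) ?mulr1 //; apply/padic_char_eq1.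
by rewrite -(addNr n%:Z); apply: pballM.
Qed.

Lemma measurable_Re_padic_char y :
  measurable_fun setT (fun x => complex.Re (chi y x)).
Proof.
have [k yk] := padic_char_locally_constant y.
by apply: (@measurable_locally_constant _ _ _ _ _ k) => x z zk; rewrite yk.
Qed.

Lemma measurable_Im_padic_char y :
  measurable_fun setT (fun x => complex.Im (chi y x)).
Proof.
have [k yk] := padic_char_locally_constant y.
by apply: (@measurable_locally_constant _ _ _ _ _ k) => x z zk; rewrite yk.
Qed.

(** The real part of the mean of the first [p^N] powers of the character
    [chi_(p^k)]. *)
Definition padic_char_mean k N x : R :=
  (p%:R ^+ N)^-1 * \sum_(j < p ^ N) complex.Re (chi (p%:R ^ k *+ j) x).

Lemma padic_char_mean_le1 k N x : `|padic_char_mean k N x| <= 1.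
Proof.
have pN : 0 < (p%:R : R) ^+ N by rewrite exprn_gt0 // ltr0n prime_gt0.
rewrite /padic_char_mean normrM gtr0_norm ?invr_gt0 // mulrC.
rewrite ler_pdivrMr // mul1r (le_trans (ler_norm_sum _ _ _)) //.
rewrite (le_trans (ler_sum _ (fun i _ => Re_padic_char_le1 _ _))) //.
by rewrite sumr_const card_ord natrX.
Qed.

Lemma measurable_padic_char_mean k N : measurable_fun setT (padic_char_mean k N).
Proof.
apply: measurable_funM => //; apply: measurable_sum => j.
exact: measurable_Re_padic_char.
Qed.

(** With [w = chi_(p^k) x], the mean is that of [w ^+ j]. On the ball
    [w = 1]. Off the ball [w] is a nontrivial root of unity whose order is a
    power of [p], and the geometric sum vanishes as soon as [p^N] is a multiple
    of this order. *)
Lemma padic_char_mean_cvg k x :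
  padic_char_mean k N x @[N --> \oo] --> (\1_(pball k) x : R).
Proof.
have pN N : (p%:R : R) ^+ N != 0.
  by rewrite expf_neq0 // gt_eqF // ltr0n prime_gt0.
pose w := chi x (p%:R ^ k).
have sE N : padic_char_mean k N x =
    (p%:R ^+ N)^-1 * complex.Re (\sum_(j < p ^ N) w ^+ j).
  rewrite raddf_sum; congr (_ * _); apply: eq_bigr => j _.
  by rewrite padic_charC padic_char_mulrn.
have [xk|xk] := pselect (pball k x).
  have w1 : w = 1 by apply/padic_char_eq1; rewrite mulrC pball_scale add0r.
  rewrite indicE mem_set //; apply: cvg_near_cst; apply: nearW => N.
  rewrite sE w1 (eq_bigr (fun=> 1)) => [|i _]; last by rewrite expr1n.
  by rewrite sumr_const card_ord raddfMn /= natrX mulVf.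
rewrite indicE memNset //.
have [n xn] := pball_ex (x * p%:R ^ k).
apply: cvg_near_cst; exists n => // N /= nN; rewrite sE.
have w1 : w != 1.
  by apply/eqP => /padic_char_eq1; rewrite mulrC pball_scale add0r.
have wN : w ^+ (p ^ N) = 1.
  rewrite -padic_char_mulrn; apply/padic_char_eq1.
  rewrite -(mulr_natr (_ ^ _)) mulrAC [_ * x]mulrC natrX [_ ^+ N]exprnP pball_scale add0r.
  by apply: pball_le xn; rewrite lez_nat.
suff -> : \sum_(j < p ^ N) w ^+ j = 0 by rewrite raddf0 mulr0.
have := subrX1 w (p ^ N); rewrite wN subrr => /esym/eqP.
by rewrite mulf_eq0 subr_eq0 (negPf w1) => /eqP.
Qed.

End Characters.

(** * Real-valued integrals *)
Section RealDominatedConvergence.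
Context d (T : measurableType d) (R : realType).
Variables (mu : {measure set T -> \bar R}) (D : set T) (mD : measurable D).
Variables (u : nat -> T -> R) (v g : T -> R).
Hypothesis mu_ : forall n, measurable_fun D (u n).
Hypothesis uv : forall x, D x -> u n x @[n --> \oo] --> v x.
Hypothesis ig : mu.-integrable D (EFin \o g).
Hypothesis ug : forall n x, D x -> `|u n x| <= g x.

Lemma dominated_Rintegral_cvg :
  (\int[mu]_(x in D) u n x)%R @[n --> \oo] --> (\int[mu]_(x in D) v x)%R.
Proof.
have mE n : measurable_fun D (EFin \o u n) by exact/measurable_EFinP.
have mv : measurable_fun D (EFin \o v).
  by apply/measurable_EFinP; apply: measurable_fun_cvg uv.
have [||iv _] := @dominated_convergence _ _ _ mu D mD (fun n => EFin \o u n)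
  (EFin \o v) (EFin \o g) mE mv _ ig.
- by apply: aeW => x Dx; apply: cvg_EFin; [exact: nearW|exact: uv].
- by apply: aeW => x n Dx; rewrite /= lee_fin ug.
rewrite -[X in _ --> X -> _]fineK; last exact: integrable_fin_num.
exact: fine_cvg.
Qed.

End RealDominatedConvergence.

Lemma Rintegral_sum d (T : measurableType d) (R : realType)
    (mu : {measure set T -> \bar R}) (D : set T) (u : nat -> T -> R) n :
  measurable D -> (forall i, mu.-integrable D (EFin \o u i)) ->
  (\int[mu]_(x in D) (\sum_(i < n) u i x))%R =
  \sum_(i < n) (\int[mu]_(x in D) u i x)%R.
Proof.
move=> mD iu; elim: n => [|n IH].
  rewrite big_ord0 (@eq_Rintegral _ _ _ mu _ (cst 0)) => [|x _].
    by rewrite Rintegral_cst // mul0r.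
  by rewrite big_ord0.
rewrite big_ord_recr /= -IH -RintegralD //.
  by apply: eq_Rintegral => x _; rewrite big_ord_recr.
rewrite (_ : EFin \o _ = (fun x => \sum_(i < n) (u i x)%:E)%E).
  by apply: integrable_sum => // i _; exact: iu.
by apply/funext => x; rewrite /= sumEFin.
Qed.

Lemma Rintegral_lincomb d (T : measurableType d) (R : realType)
    (mu : {measure set T -> \bar R}) (D : set T) (u v : T -> R) (r s : R) :
  measurable D -> mu.-integrable D (EFin \o u) -> mu.-integrable D (EFin \o v) ->
  (\int[mu]_(x in D) (r * u x + s * v x))%R =
  r * (\int[mu]_(x in D) u x)%R + s * (\int[mu]_(x in D) v x)%R.
Proof.
move=> mD iu iv; rewrite RintegralD ?RintegralZl //.
- by have := integrableZl mD r iu.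
- by have := integrableZl mD s iv.
Qed.

(** * Integrals of characters over balls *)
Section HaarIntegral.
Variables (R : realType) (p : nat) (hp : prime p).
Local Notation Qp := (padic hp).
Variables (haar : {measure set Qp -> \bar R}) (hhaar : padic_haar haar).
Implicit Types (x y a : Qp) (k : int).
Local Notation chi := (@padic_char R p hp).

Lemma haar_pball_lty k : (haar (pball k) < +oo)%E.
Proof. by rewrite haar_pball // ltry. Qed.

Lemma bounded_integrable_pball (F : Qp -> R) k : measurable_fun setT F ->
  (forall x, `|F x| <= 1) -> haar.-integrable (pball k) (EFin \o F).
Proof.
move=> mF F1; apply: measurable_bounded_integrable.
- exact: measurable_pball0.
- exact: haar_pball_lty.
- exact: measurable_funTS.
- by exists 1; split=> // M M1 x _; apply: le_trans (F1 x) (ltW M1).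
Qed.

Lemma Rintegral_pball_translate (F : Qp -> R) k a : measurable_fun setT F ->
  (forall x, `|F x| <= 1) -> pball k a ->
  (\int[haar]_(x in pball k) F (a + x))%R = (\int[haar]_(x in pball k) F x)%R.
Proof.
move=> mF F1 ak; have mk := measurable_pball0 (hp := hp) k.
have mt := measurable_translate a.
have preE : +%R a @^-1` pball k = pball k.
  by apply/seteqP; split=> x /=; rewrite pballDl.
have invE A : measurable A -> A `<=` pball k -> pushforward haar (+%R a) A = haar A.
  move=> mA _; rewrite /pushforward.
  have [H _] := hhaar; rewrite -[RHS](H (- a)) //.
  congr (haar _); apply/seteqP; split=> x /=.
    by move=> Aax; exists (a + x) => //; rewrite addKr.
  by case=> y Ay <-; rewrite addNKr.
have E : (\int[pushforward haar (+%R a)]_(x in pball k) (EFin \o F) x =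
    \int[haar]_(x in pball k) (EFin \o F \o +%R a) x)%E.
  rewrite -[in RHS]preE; apply: integral_pushforward => //.
    exact/measurable_EFinP.
  rewrite preE; apply: (@bounded_integrable_pball (F \o +%R a)) => //.
  exact: measurableT_comp.
  by move=> x; exact: F1.
by rewrite /Rintegral -E; congr fine; apply: eq_measure_integral.
Qed.

(** The indicator of the ball of radius [p^k] has Fourier transform [p^k] times
    the indicator of the dual ball. Off the dual ball the character takes a
    value [w != 1] at the point [p^-k] of the ball, and translating by this
    point shows that the integral is equal to [w] times itself. *)
Lemma padic_char_integral y k :
  (\int[haar]_(x in pball k) complex.Re (chi y x))%R
    = p%:R ^ k * \1_(pball (- k)) y /\
  (\int[haar]_(x in pball k) complex.Im (chi y x))%R = 0.
Proof.
have mk := measurable_pball0 (hp := hp) k.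
have [yk|yk] := pselect (pball (- k) y).
  have chi1 x : x \in pball k -> chi y x = 1.
    rewrite inE => xk; apply/padic_char_eq1.
    by rewrite -(subrr k); apply: pballM.
  rewrite indicE mem_set // mulr1; split.
    rewrite (@eq_Rintegral _ _ _ haar _ (cst 1)) => [|x /chi1 -> //].
    by rewrite Rintegral_cst // mul1r haar_pball.
  rewrite (@eq_Rintegral _ _ _ haar _ (cst 0)) => [|x /chi1 -> //].
  by rewrite Rintegral_cst // mul0r.
rewrite indicE memNset // mulr0.
pose x0 : Qp := p%:R ^ (- k).
have x0k : pball k x0 by rewrite pball_pz opprK.
pose w := chi y x0.
have w1 : w != 1.
  apply/eqP => /padic_char_eq1; rewrite mulrC pball_scale.
  by rewrite sub0r.
have mRe := @measurable_Re_padic_char R p hp y.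
have mIm := @measurable_Im_padic_char R p hp y.
have iRe := bounded_integrable_pball k mRe (@Re_padic_char_le1 R p hp y).
have iIm := bounded_integrable_pball k mIm (@Im_padic_char_le1 R p hp y).
set a := (\int[haar]_(x in _) complex.Re _)%R.
set b := (\int[haar]_(x in _) complex.Im _)%R.
have tRe : (\int[haar]_(x in pball k) complex.Re (chi y (x0 + x)))%R = a.
  exact: Rintegral_pball_translate mRe (@Re_padic_char_le1 R p hp y) x0k.
have tIm : (\int[haar]_(x in pball k) complex.Im (chi y (x0 + x)))%R = b.
  exact: Rintegral_pball_translate mIm (@Im_padic_char_le1 R p hp y) x0k.
have aL r s : (\int[haar]_(x in pball k)
    (r * complex.Re (chi y x) + s * complex.Im (chi y x)))%R = r * a + s * b.
  exact: Rintegral_lincomb.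
have bL r s : (\int[haar]_(x in pball k)
    (r * complex.Im (chi y x) + s * complex.Re (chi y x)))%R = r * b + s * a.
  exact: Rintegral_lincomb.
clearbody a b.
have aE : complex.Re w * a + - complex.Im w * b = a.
  rewrite -aL.
  transitivity (\int[haar]_(x in pball k) complex.Re (chi y (x0 + x)))%R; last exact: tRe.
  apply: eq_Rintegral => x _; rewrite padic_charD -/w.
  by case: (w) (chi y x) => ? ? [? ?] /=; rewrite mulNr.
have bE : complex.Re w * b + complex.Im w * a = b.
  rewrite -bL.
  transitivity (\int[haar]_(x in pball k) complex.Im (chi y (x0 + x)))%R; last exact: tIm.
  apply: eq_Rintegral => x _; rewrite padic_charD -/w.
  by case: (w) (chi y x) => ? ? [].
have : (w - 1) * (a +i* b) = 0.
  rewrite mulrBl mul1r (_ : w * _ = (complex.Re w * a + - complex.Im w * b)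
    +i* (complex.Re w * b + complex.Im w * a)); last first.
    by case: (w) => ? ?; rewrite mulNr.
  by rewrite aE bE subrr.
by move/eqP; rewrite mulf_eq0 subr_eq0 (negPf w1) /= => /eqP[a0 b0].
Qed.

End HaarIntegral.

(** * Masses of balls from the Fourier transform *)
Section BallInversion.
Variables (R : realType) (p : nat) (hp : prime p).
Local Notation Qp := (padic hp).
Variables (mu : {measure set Qp -> \bar R}) (f : Qp -> R).
Hypothesis intf : mu.-integrable setT (EFin \o f).
Local Notation chi := (@padic_char R p hp).

Lemma integrable_boundedM (F : Qp -> R) : measurable_fun setT F ->
  (forall x, `|F x| <= 1) -> mu.-integrable setT (EFin \o (F \* f)).
Proof.
move=> mF F1; apply: le_integrable intf => //.
  apply/measurable_EFinP; apply: measurable_funM => //.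
  by apply/measurable_EFinP; exact: measurable_int intf.
by move=> x _ /=; rewrite lee_fin normrM ler_piMl.
Qed.

Definition weighted_cos y := (\int[mu]_x (complex.Re (chi y x) * f x))%R.
Definition weighted_sin y := (\int[mu]_x (complex.Im (chi y x) * f x))%R.

Lemma Rintegral_char_sub y a :
  (\int[mu]_x (complex.Re (chi y (x - a)) * f x))%R =
  complex.Re (chi y a) * weighted_cos y + complex.Im (chi y a) * weighted_sin y.
Proof.
have iRe := integrable_boundedM (@measurable_Re_padic_char R p hp y)
  (@Re_padic_char_le1 R p hp y).
have iIm := integrable_boundedM (@measurable_Im_padic_char R p hp y)
  (@Im_padic_char_le1 R p hp y).
rewrite -Rintegral_lincomb //.
apply: eq_Rintegral => x _; rewrite padic_charD padic_charN /=.
by case: (chi y x) (chi y a) => ? ? [? ?] /=; ring.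
Qed.

(** The left-hand side depends on [mu] and [f] only through the Fourier
    transform of the measure with density [f], so two such measures with the
    same transform have the same mass on balls. The weight allows for both a
    probability measure ([f] constant) and a density with respect to Haar
    measure. *)
Lemma ball_inversion k a :
  (p%:R ^+ N)^-1 * \sum_(j < p ^ N)
     (let y := p%:R ^ k *+ j in complex.Re (chi y a) * weighted_cos y
        + complex.Im (chi y a) * weighted_sin y) @[N --> \oo] -->
  (\int[mu]_(x in [set x | pball k (x - a)]) f x)%R.
Proof.
have mf : measurable_fun setT f.
  by apply/measurable_EFinP; exact: measurable_int intf.
have mB : measurable_fun setT (fun x : Qp => x - a).
  by rewrite (_ : (fun _ => _) = +%R (- a)); [exact: measurable_translate|
    apply/funext => x; rewrite addrC].
have -> : (\int[mu]_(x in [set x | pball k (x - a)]) f x)%R =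
    (\int[mu]_x (\1_(pball k) (x - a) * f x))%R.
  rewrite Rintegral_mkcond; apply: eq_Rintegral => x _.
  rewrite patchE indicE; have [xa|xa] := pselect (pball k (x - a)).
    by rewrite !mem_set // mul1r.
  by rewrite !memNset // mul0r.
rewrite (_ : (fun N => _) = (fun N =>
    (\int[mu]_x (padic_char_mean R k N (x - a) * f x))%R)); last first.
  apply/funext => N; under eq_bigr do rewrite /= -Rintegral_char_sub.
  have mRe y : measurable_fun setT (fun x : Qp => complex.Re (chi y (x - a))).
    exact: measurableT_comp (@measurable_Re_padic_char R p hp y) mB.
  have iRe y := integrable_boundedM (mRe y)
    (fun x => @Re_padic_char_le1 R p hp y (x - a)).
  rewrite -(@Rintegral_sum _ _ _ mu setT
    (fun j x => complex.Re (chi (p%:R ^ k *+ j) (x - a)) * f x)) //;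
    last by move=> j; exact: iRe.
  rewrite -RintegralZl //.
    by apply: eq_Rintegral => x _; rewrite -mulr_suml mulrA.
  rewrite (_ : EFin \o _ = (fun x => \sum_(j < p ^ N)
    (complex.Re (chi (p%:R ^ k *+ j) (x - a)) * f x)%:E)%E).
    by apply: integrable_sum => // j _; exact: iRe.
  by apply/funext => x; rewrite /= sumEFin.
apply: (@dominated_Rintegral_cvg _ _ _ _ _ _ _ _ (fun x => `|f x|)) => //.
- move=> N; apply: measurable_funM => //.
  exact: measurableT_comp (@measurable_padic_char_mean R p hp k N) mB.
- by move=> x _; apply: cvgMr_tmp; exact: padic_char_mean_cvg.
- exact: integrable_norm intf.
- move=> N x _; rewrite normrM ler_piMl // padic_char_mean_le1 //.
Qed.

End BallInversion.

(** * Positive combinations of indicators of balls *)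
Section RadialSeries.
Variables (R : realType) (p : nat) (hp : prime p).
Local Notation Qp := (padic hp).
Local Notation chi := (@padic_char R p hp).
Variables (k : nat -> int) (c : nat -> R) (g : Qp -> R).
Hypothesis c_ge0 : forall i, 0 <= c i.
Let term (y : Qp) i : R := c i * \1_(pball (k i)) y.
Hypothesis gE : forall y, series (term y) @ \oo --> g y.

Let term_ge0 y i : 0 <= term y i.
Proof. by rewrite mulr_ge0. Qed.

Let term_nd y : {homo series (term y) : m n / (m <= n)%N >-> m <= n}.
Proof. by apply: nondecreasing_series => n _ _; exact: term_ge0. Qed.

Let partial_le y n : series (term y) n <= g y.
Proof.
rewrite -(cvg_lim (@Rhausdorff R) (@gE y)).
by apply: nondecreasing_cvgn_le => //; apply/cvg_ex; exists (g y).
Qed.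

Lemma radial_ge0 y : 0 <= g y.
Proof. by have := partial_le y 0; rewrite /series /= big_geq. Qed.

Lemma radial_term_le y i : c i * \1_(pball (k i)) y <= g y.
Proof.
rewrite (le_trans _ (partial_le y i.+1)) // /series /= big_nat_recr //=.
by rewrite lerDr sumr_ge0.
Qed.

Lemma measurable_radial_term i : measurable_fun setT (fun y => term y i).
Proof.
apply: measurable_funM => //; apply: measurable_indic.
exact: measurable_pball0.
Qed.

Lemma measurable_radial : measurable_fun setT g.
Proof.
apply: (@measurable_fun_cvg _ _ _ setT (fun n y => series (term y) n)) => // n.
by apply: measurable_sum => i; exact: measurable_radial_term.
Qed.

Section Continuity.
Hypothesis cvg_c : cvgn (series c).

(** The sums of [c i (1 - 1_ball)] also increase, which bounds the tail of [g]
    by that of [c], uniformly in [y]. *)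
Let tail_le y n : g y - series (term y) n <= limn (series c) - series c n.
Proof.
pose u i := c i * (1 - \1_(pball (k i)) y).
have uE m : series u m = series c m - series (term y) m.
  rewrite /series /= -sumrB; apply: eq_bigr => i _.
  by rewrite /u /term mulrBr mulr1.
have u_cvg : series u @ \oo --> limn (series c) - g y.
  by rewrite (_ : series u = series c \- series (term y));
    [apply: cvgB|apply/funext].
have : series u n <= limn (series u).
  apply: nondecreasing_cvgn_le; last by apply/cvg_ex; eexists; exact: u_cvg.
  apply: nondecreasing_series => i _ _; rewrite /u mulr_ge0 // subr_ge0.
rewrite (cvg_lim (@Rhausdorff R) u_cvg) uE; lra.
Qed.

Let exponent_lb n : exists m, forall i, (i < n)%N -> m <= k i.
Proof.
elim: n => [|n [m mk]]; first by exists 0.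
exists (Num.min m (k n)) => i; rewrite ltnS leq_eqVlt => /predU1P[->|/mk mi].
  by rewrite ge_min lexx orbT.
by rewrite ge_min mi.
Qed.

(** A partial sum is constant on cosets of the smallest ball involved, and the
    remainder is uniformly small. *)
Lemma radial_continuous : continuous g.
Proof.
move=> x A /nbhs_ballP[e /= e0 eA].
have [N _ Ne] : \forall n \near \oo, `|limn (series c) - series c n| < e.
  by move/cvgrPdist_lt: cvg_c => /(_ _ e0).
have [m mk] := exponent_lb N.
have mx : nbhs x [set y | pball m (y - x)].
  apply: open_nbhs_nbhs; split; first exact: open_pball.
  by rewrite /= subrr; apply: pball0.
change (nbhs x (g @^-1` A)); apply: filterS mx => y /= yx; apply: eA.
rewrite /ball /=.
have SE : series (term y) N = series (term x) N.
  rewrite /series /= !big_mkord; apply: eq_bigr => i _; congr (_ * _).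
  have iE : pball (k i) y = pball (k i) x.
    rewrite -(subrK x y) pballDl //; apply: pball_le yx.
    exact: mk.
  by rewrite !indicE /in_mem /mem /= /in_set iE.
have := tail_le x N; have := tail_le y N; rewrite SE.
have := partial_le x N; have := partial_le y N; rewrite SE.
have := Ne N (leqnn N) => /=; rewrite ltr_norml => /andP[_].
rewrite ltr_norml => ? ? ? ? ?; apply/andP; split; lra.
Qed.

End Continuity.

Section Integral.
Variables (haar : {measure set Qp -> \bar R}) (hhaar : padic_haar haar).
Hypothesis cvg_cp : cvgn (series (fun i => c i * p%:R ^ k i)).

Lemma radial_integrable : haar.-integrable setT (EFin \o g).
Proof.
have mg := measurable_radial.
apply/integrableP; split; first exact/measurable_EFinP.
under eq_integral do rewrite /= ger0_norm ?radial_ge0 //.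
rewrite (eq_integral (fun y => \sum_(i <oo) (term y i)%:E)%E) => [|y _]; last first.
  rewrite -(cvg_lim (@Rhausdorff R) (@gE y)) -EFin_lim; last first.
    by apply/cvg_ex; exists (g y).
  by congr (limn _); apply/funext => n /=; rewrite /series /= sumEFin.
rewrite integral_nneseries //; last 2 first.
- by move=> i; apply/measurable_EFinP; exact: measurable_radial_term.
- by move=> i y _; rewrite lee_fin.
rewrite (eq_eseriesr (g := fun i => (c i * p%:R ^ k i)%:E)) => [|i _]; last first.
  under eq_integral do rewrite EFinM.
  rewrite ge0_integralZl_EFin //.
  - rewrite integral_indic ?setIT ?haar_pball //; exact: measurable_pball0.
  - by apply/measurable_EFinP/measurable_indic; exact: measurable_pball0.
rewrite (_ : (\sum_(i <oo) _)%E = (limn (series (fun i => c i * p%:R ^ k i)))%:E).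
  exact: ltry.
rewrite -EFin_lim //; congr (limn _); apply/funext => n /=.
by rewrite /series /= sumEFin.
Qed.

(** The partial sums times [F] are dominated by [g] itself. *)
Lemma radial_integral_cvg (F : Qp -> R) : measurable_fun setT F ->
  (forall y, `|F y| <= 1) ->
  series (fun i => c i * (\int[haar]_(y in pball (k i)) F y)%R) @ \oo -->
  (\int[haar]_y (F y * g y))%R.
Proof.
move=> mF F1.
have iF i : haar.-integrable setT (EFin \o (fun y => F y * term y i)).
  apply: le_integrable radial_integrable => //.
    apply/measurable_EFinP; apply: measurable_funM => //.
    exact: measurable_radial_term.
  move=> y _ /=; rewrite lee_fin normrM (ger0_norm (term_ge0 y i)).
  rewrite (ger0_norm (radial_ge0 y)) (le_trans _ (radial_term_le y i)) //.
  by rewrite ler_piMl.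
have iB i : haar.-integrable (pball (k i)) (EFin \o F).
  exact: bounded_integrable_pball.
rewrite (_ : series _ = (fun n => (\int[haar]_y (F y * series (term y) n))%R)).
  apply: (@dominated_Rintegral_cvg _ _ _ haar setT _ _ _ g) => //.
  - move=> n; apply: measurable_funM => //.
    by apply: measurable_sum => i; exact: measurable_radial_term.
  - by move=> y _; apply: cvgMl_tmp; exact: gE.
  - exact: radial_integrable.
  - move=> n y _; rewrite normrM.
    have S0 : 0 <= series (term y) n by apply: sumr_ge0.
    by rewrite (ger0_norm S0) (le_trans _ (partial_le y n)) // ler_piMl.
apply/funext => n; rewrite /series /= big_mkord.
transitivity (\sum_(i < n) (\int[haar]_y (F y * term y i))%R).
  apply: eq_bigr => i _; rewrite -RintegralZl //; last exact: measurable_pball0.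
  rewrite Rintegral_mkcond; apply: eq_Rintegral => y _.
  rewrite patchE /term indicE; case: (y \in _); first by rewrite mulr1 mulrC.
  by rewrite !mulr0.
rewrite -(@Rintegral_sum _ _ _ haar setT (fun i y => F y * term y i)) //.
by apply: eq_Rintegral => y _; rewrite big_mkord mulr_sumr.
Qed.

(** The limit is a parameter rather than a formula, because the lemma is applied
    both to the symbol and to the density, each being the transform of the
    other. *)
Lemma radial_fourier (h : Qp -> R) x :
  series (fun i => c i * p%:R ^ k i * \1_(pball (- k i)) x) @ \oo --> h x ->
  (\int[haar]_y (complex.Re (chi x y) * g y))%R = h x /\
  (\int[haar]_y (complex.Im (chi x y) * g y))%R = 0.
Proof.
move=> hE; split.
  have := radial_integral_cvg (@measurable_Re_padic_char R p hp x)
    (@Re_padic_char_le1 R p hp x).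
  rewrite (_ : (fun i => c i * _) =
    (fun i => c i * p%:R ^ k i * \1_(pball (- k i)) x)); last first.
    by apply/funext => i; rewrite (padic_char_integral hhaar _ _).1 mulrA.
  by move=> /(cvg_unique (@Rhausdorff R)); apply.
have := radial_integral_cvg (@measurable_Im_padic_char R p hp x)
  (@Im_padic_char_le1 R p hp x).
move=> /(cvg_unique (@Rhausdorff R)); apply.
rewrite (_ : series _ = cst 0); first exact: cvg_cst.
apply/funext => n; rewrite /series /= big1 // => i _.
by rewrite (padic_char_integral hhaar _ _).2 mulr0.
Qed.

End Integral.
End RadialSeries.

(** * Measures with a density *)
Section DensityMeasure.
Context d (T : measurableType d) (R : realType).
Variables (mu : {measure set T -> \bar R}) (f : T -> R).
Hypotheses (mf : measurable_fun setT f) (f_ge0 : forall x, 0 <= f x).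

(** The proofs are arguments so that the measure structure can be inferred. *)
Definition density_measure of measurable_fun setT f & (forall x, 0 <= f x) :=
  fun A : set T => (\int[mu]_(x in A) (f x)%:E)%E.
Local Notation nu := (density_measure mf f_ge0).

Let nu0 : nu set0 = 0%E.
Proof. exact: integral_set0. Qed.

Let nu_ge0 A : (0 <= nu A)%E.
Proof. by apply: integral_ge0 => x _; rewrite lee_fin. Qed.

Let nu_sigma_additive : semi_sigma_additive nu.
Proof.
move=> /= A mA tA mUA; rewrite /density_measure ge0_integral_bigcup //.
- apply: is_cvg_ereal_nneg_natsum_cond => n _ _.
  by apply: integral_ge0 => x _; rewrite lee_fin.
- by apply/measurable_EFinP; apply: measurable_funS mf.
- by move=> x _; rewrite lee_fin.
Qed.

HB.instance Definition _ := isMeasure.Build _ _ _ nu nu0 nu_ge0 nu_sigma_additive.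

End DensityMeasure.

Lemma density_of_pballs (R : realType) (p : nat) (hp : prime p)
    (mu : {measure set (padic hp) -> \bar R}) (P : probability (padic hp) R)
    (f : padic hp -> R) : measurable_fun setT f -> (forall x, 0 <= f x) ->
  (forall k (a : padic hp), P [set x | pball k (x - a)] =
    (\int[mu]_(x in [set x : padic hp | pball k (x - a)%R]) (f x)%:E)%E) ->
  forall A, measurable A -> P A = (\int[mu]_(x in A) (f x)%:E)%E.
Proof.
move=> mf f0 Pf A mA.
apply: (@measure_unique _ R _ (@pballs p hp) (fun n => pball n%:Z) _ _ _ _ P
  (density_measure mu mf f0)) => //.
- exact: measurable_pballs.
- exact: pballs_setI.
- move=> n; right; exists n%:Z, 0; apply/seteqP.
  by split=> x; rewrite /= subr0.
- exact: bigcup_pball.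
- move=> B [->|[k [a ->]]]; first by rewrite !measure0.
  exact: Pf.
- move=> n; rewrite (le_lt_trans (probability_le1 _ _)) ?ltry //.
  exact: measurable_pball0.
Qed.

(** * Series indexed by the integers *)
Section Interleaving.
Variable R : realType.

(** The enumeration 0, -1, 1, -2, 2, ...; its first [2n] values are the
    integers from [-n] to [n-1], over which sums telescope. *)
Definition zenum (i : nat) : int := if odd i then - i./2.+1%:Z else i./2%:Z.

Lemma zenum_double n : zenum n.*2 = n%:Z.
Proof. by rewrite /zenum odd_double doubleK. Qed.

Lemma zenum_doubleS n : zenum n.*2.+1 = - n.+1%:Z.
Proof. by rewrite /zenum /= odd_double /= uphalf_double. Qed.

Lemma series_zenum_double (F : int -> R) n :
  series (F \o zenum) n.*2 = \sum_(j < n) (F j%:Z + F (- j.+1%:Z)).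
Proof.
rewrite /series /=; elim: n => [|n IH]; first by rewrite big_geq // big_ord0.
rewrite doubleS !big_nat_recr //= IH big_ord_recr /=.
by rewrite zenum_double zenum_doubleS addrA.
Qed.

Lemma series_zenum_telescope (a : int -> R) n :
  series (fun i => a (zenum i) - a (zenum i + 1)) n.*2 = a (- n%:Z) - a n%:Z.
Proof.
rewrite (series_zenum_double (fun k => a k - a (k + 1))).
elim: n => [|n IH]; first by rewrite big_ord0 oppr0 subrr.
rewrite big_ord_recr /= IH (_ : - n.+1%:Z + 1 = - n%:Z); last first.
  by rewrite -addn1 PoszD; ring.
rewrite -PoszD addn1; ring.
Qed.

Lemma nondecreasing_even_cvg (u : nat -> R) (l : R) :
  {homo u : m n / (m <= n)%N >-> m <= n} ->
  u n.*2 @[n --> \oo] --> l -> u @ \oo --> l.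
Proof.
move=> nd ul.
have ule n : u n <= l.
  have -> : l = limn (fun n => u n.*2) by apply/esym/cvg_lim.
  apply: le_trans (nondecreasing_cvgn_le _ _ n) => //.
  - by apply: nd; rewrite -addnn leq_addr.
  - by move=> i j ij; apply: nd; rewrite leq_double.
  - by apply/cvg_ex; exists l.
apply/cvgrPdist_lt => e e0; move/cvgrPdist_lt: ul => /(_ _ e0)[N _ Ne].
exists N.*2 => // n /= Nn; have := Ne N (leqnn N) => /=.
rewrite !ger0_norm ?subr_ge0 //; apply: le_lt_trans.
by rewrite lerD2l lerN2; apply: nd.
Qed.

Lemma nneg_series_nd (c : nat -> R) : (forall i, 0 <= c i) ->
  {homo series c : m n / (m <= n)%N >-> m <= n}.
Proof. by move=> c0; apply: nondecreasing_series => n _ _. Qed.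

Lemma even_bounded_series_cvg (c : nat -> R) M : (forall i, 0 <= c i) ->
  (forall n, series c n.*2 <= M) -> cvgn (series c).
Proof.
move=> c0 cM; apply: nondecreasing_is_cvgn; first exact: nneg_series_nd.
exists M => _ [n _ <-]; rewrite (le_trans _ (cM n)) //.
by apply: nneg_series_nd; rewrite // -addnn leq_addr.
Qed.

End Interleaving.

(** * The symbol as a combination of balls *)
Section StableSymbol.
Variables (R : realType) (p : nat) (hp : prime p) (b gamma : R).
Hypotheses (b0 : 0 < b) (gamma0 : 0 < gamma).
Local Notation Qp := (padic hp).

Definition stable_symbol (y : Qp) : R := expR (- (b * padic_abs R y `^ gamma)).
(** The value of the symbol on the sphere of radius [p^k]. *)
Definition sphere_value (k : int) : R := expR (- (b * (p%:R ^ k) `^ gamma)).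
Local Notation e := sphere_value.

Let q : R := p%:R `^ gamma.

Let p_gt1 : 1 < (p%:R : R).
Proof. exact: pF_gt1. Qed.

Let q_gt1 : 1 < q.
Proof.
have {1}<- : 1 `^ gamma = 1 :> R by rewrite powR1.
by rewrite gt0_ltr_powR // nnegrE ?ler0n.
Qed.

Let sphere_valueE k : e k = expR (- (b * q ^ k)).
Proof.
congr (expR (- (b * _))).
by rewrite -powR_intmul ?ler0n // powRAC powR_intmul // powR_ge0.
Qed.

Lemma sphere_value_ge0 k : 0 <= e k.
Proof. exact: expR_ge0. Qed.

Lemma sphere_value_le1 k : e k <= 1.
Proof.
by rewrite sphere_valueE -expR0 ler_expR oppr_le0 mulr_ge0 ?exprz_ge0 ?powR_ge0 // ltW.
Qed.

Lemma sphere_value_noninc k l : k <= l -> e l <= e k.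
Proof.
move=> kl; rewrite !sphere_valueE ler_expR lerN2 ler_pM2l //.
by rewrite ler_eXz2l.
Qed.

(** The symbol beats any power of the norm; the factor [2^-n] makes the series
    with terms [e n * p^n] geometric. With [u = b q^n], the bound
    [(u / m)^m <= exp u] is used for an [m] such that [q^m >= 2p]. *)
Lemma sphere_value_decay : exists2 K, 0 <= K &
  forall n : nat, e n%:Z * p%:R ^+ n <= K * 2^-1 ^+ n.
Proof.
have q0 : 0 < q by rewrite (lt_trans _ q_gt1).
have p2 : 0 < (p%:R * 2 : R) by rewrite mulr_gt0 // (lt_trans _ p_gt1).
have [m qm] : exists m : nat, p%:R * 2 <= q ^+ m.+1.
  (* Any exponent works for which [q^-1] to that power is below [1 / (2p)]; a
     successor is chosen because [u] is divided by it below. *)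
  have qV : `|q^-1| < 1 by rewrite gtr0_norm ?invr_gt0 // invf_lt1.
  have /cvgrPdist_lt/(_ (p%:R * 2)^-1) := cvg_expr qV.
  rewrite invr_gt0 p2 => /(_ isT)[N _ Nq]; exists N.
  have := Nq N.+1 (leqnSn N) => /=.
  rewrite sub0r normrN gtr0_norm ?exprn_gt0 ?invr_gt0 //.
  by rewrite exprVn ltf_pV2 ?posrE ?exprn_gt0 // => /ltW.
have m0 : 0 < (m.+1%:R : R) by rewrite ltr0n.
exists ((m.+1%:R / b) ^+ m.+1) => [|n].
  by rewrite exprn_ge0 // divr_ge0 // ltW.
rewrite exprVn ler_pdivlMr ?exprn_gt0 // -mulrA -exprMn.
rewrite sphere_valueE; set u := b * q ^ n%:Z.
have u0 : 0 < u by rewrite mulr_gt0 // exprz_gt0.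
have eu : expR (- u) <= (m.+1%:R / u) ^+ m.+1.
  rewrite expRN -[X in _ <= X]invrK -exprVn invf_div lef_pV2
    ?posrE ?expR_gt0 //; last first.
    by rewrite exprn_gt0 // divr_gt0.
  have -> : expR u = expR (u / m.+1%:R) ^+ m.+1.
    by rewrite -expRM_natl mulrC divfK ?gt_eqF.
  rewrite lerXn2r ?nnegrE ?expR_ge0 ?divr_ge0 ?(ltW u0) ?(ltW m0) //.
  by rewrite (le_trans _ (expR_ge1Dx _)) // lerDr.
have -> : (m.+1%:R / b) ^+ m.+1 = (m.+1%:R / u) ^+ m.+1 * (q ^+ m.+1) ^+ n.
  rewrite exprAC -exprMn; congr (_ ^+ _); rewrite /u -exprnP.
  by field; rewrite !gt_eqF // exprn_gt0.
rewrite ler_pM ?expR_ge0 ?exprn_ge0 ?(ltW p2) //.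
by rewrite lerXn2r ?nnegrE ?exprn_ge0 ?(ltW p2) ?(ltW q0).
Qed.

Lemma sphere_value_cvg0 : e n%:Z @[n --> \oo] --> (0 : R).
Proof.
have [K K0 Ke] := sphere_value_decay.
apply: (@squeeze_cvgr _ _ _ _ (cst 0) (geometric K 2^-1)).
- apply: nearW => n /=; rewrite sphere_value_ge0 /=.
  by rewrite (le_trans _ (Ke n)) // ler_peMr ?sphere_value_ge0 // exprn_ege1 // ltW.
- exact: cvg_cst.
- by apply: cvg_geometric; rewrite ger0_norm ?invr_ge0 // invf_lt1 // ltr1n.
Qed.

Lemma sphere_value_cvg1 : e (- n%:Z) @[n --> \oo] --> (1 : R).
Proof.
rewrite (_ : (fun n : nat => _) = (fun n => expR (- (b * q^-1 ^+ n)))); last first.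
  by apply/funext => n; rewrite sphere_valueE -exprnN exprVn.
rewrite -(expR0 R); apply: continuous_cvg; first exact: continuous_expR.
rewrite -[X in _ --> X]oppr0; apply: cvgN.
rewrite -(mulr0 b); apply: cvgMl_tmp; apply: cvg_expr.
rewrite ger0_norm ?invr_ge0 ?powR_ge0 // invf_lt1 //.
exact: lt_trans q_gt1.
Qed.

(** The coefficient of the ball of radius [p^k], for [k = zenum i], in the
    summation by parts. *)
Definition ball_weight i : R := e (zenum i) - e (zenum i + 1).

Lemma ball_weight_ge0 i : 0 <= ball_weight i.
Proof. by rewrite subr_ge0 sphere_value_noninc // lerDl. Qed.

Lemma ball_weight_summable : cvgn (series ball_weight).
Proof.
apply: (@even_bounded_series_cvg _ _ 1); first exact: ball_weight_ge0.
move=> n; rewrite series_zenum_telescope lerBlDr.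
by rewrite (le_trans (sphere_value_le1 _)) // lerDl sphere_value_ge0.
Qed.

(** For nonnegative exponents the decay of the symbol is used; for negative
    ones the weights are at most 1 and [p^k] is summable. *)
Lemma ball_weightM_summable :
  cvgn (series (fun i => ball_weight i * p%:R ^ zenum i)).
Proof.
have [K K0 Ke] := sphere_value_decay.
apply: (@even_bounded_series_cvg _ _ ((K + 1) * 2)) => [i|n].
  by rewrite mulr_ge0 ?ball_weight_ge0 // ltW // pV_gt0.
rewrite (series_zenum_double (fun k => (e k - e (k + 1)) * p%:R ^ k)).
apply: (@le_trans _ _ (\sum_(j < n) (K + 1) * 2^-1 ^+ j)).
  apply: ler_sum => j _; rewrite (mulrDl K) mul1r lerD //.
    rewrite (le_trans _ (Ke j)) // ler_wpM2r ?exprz_ge0 ?ler0n //.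
    by rewrite gerBl sphere_value_ge0.
  rewrite -[2^-1 ^+ j]mul1r ler_pM //.
  - by rewrite subr_ge0 sphere_value_noninc // lerDl.
  - by rewrite (le_trans _ (sphere_value_le1 (- j.+1%:Z))) // gerBl sphere_value_ge0.
  - rewrite -exprnN exprVn lef_pV2 ?posrE ?exprn_gt0 ?(lt_trans _ p_gt1) //.
    rewrite (@le_trans _ _ (p%:R ^+ j)) //.
      by rewrite lerXn2r ?nnegrE ?ler0n // ler_nat prime_gt1.
    by rewrite ler_eXn2l.
rewrite -mulr_sumr ler_wpM2l ?addr_ge0 //.
have : (1 - 2^-1) * (\sum_(j < n) 2^-1 ^+ j) = 1 - 2^-1 ^+ n :> R.
  by have := subrX1 (2^-1 : R) n; lra.
have : 0 <= 2^-1 ^+ n :> R by rewrite exprn_ge0 // invr_ge0.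
lra.
Qed.

(** On the sphere of radius [p^l] the term of index [k] is the increment
    [e (max k l) - e (max (k+1) l)], zero for [k < l], so that the
    sum telescopes to [e l]. At the origin all indicators are 1 and the sum
    telescopes to the difference of the limits of [e] at minus and plus
    infinity. *)
Lemma stable_symbol_series y :
  series (fun i => ball_weight i * \1_(pball (zenum i)) y) @ \oo -->
  stable_symbol y.
Proof.
apply: nondecreasing_even_cvg.
  by apply: nneg_series_nd => i; rewrite mulr_ge0 ?ball_weight_ge0.
have [->|y0] := eqVneq y 0.
  have -> : (fun i => ball_weight i * \1_(pball (zenum i)) (0 : Qp)) = ball_weight.
    by apply/funext => i; rewrite indicE mem_set ?mulr1 //; exact: pball0.
  under eq_fun do rewrite series_zenum_telescope.
  have -> : stable_symbol 0 = 1 - 0.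
    rewrite /stable_symbol /padic_abs padic_norm0 rmorph0 powR0 ?gt_eqF //.
    by rewrite mulr0 oppr0 expR0 addr0.
  by apply: cvgB; [exact: sphere_value_cvg1|exact: sphere_value_cvg0].
have [l yl] := padic_norm_pz_ex y0.
have -> : stable_symbol y = e l.
  by rewrite /stable_symbol /padic_abs yl fmorphXz /= ratr_nat.
have -> : (fun i => ball_weight i * \1_(pball (zenum i)) y) =
    (fun i => e (Num.max (zenum i) l) - e (Num.max (zenum i + 1) l)).
  apply/funext => i; rewrite indicE /ball_weight.
  have [li|il] := leP l (zenum i).
    have yi : pball (zenum i) y by rewrite /pball /= yl (ler_pz hp).
    rewrite (mem_set yi) mulr1.
    by rewrite (max_idPl _) // (le_trans li) // lerDl.
  have yi : ~ pball (zenum i) y.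
    by rewrite /pball /= yl (ler_pz hp) => /(lt_le_trans il); rewrite ltxx.
  by rewrite (memNset yi) mulr0 !(max_idPr _) ?subrr ?lezD1 // ltW.
under eq_fun do rewrite (series_zenum_telescope (fun k => e (Num.max k l))).
apply: (@cvg_trans _ ((fun n : nat => e l - e n%:Z) @ \oo)).
  apply: near_eq_cvg; exists `|l|%N => // n /= ln.
  by congr (e _ - e _); [rewrite (max_idPr _)|rewrite (max_idPl _)]; lia.
have : (fun n : nat => e l - e n%:Z) @ \oo --> e l - 0.
  by apply: cvgB; [exact: cvg_cst|exact: sphere_value_cvg0].
by rewrite subr0.
Qed.

End StableSymbol.

(** * The density *)
Section StableDensity.
Variables (R : realType) (p : nat) (hp : prime p).
Local Notation Qp := (padic hp).
Variables (haar : {measure set Qp -> \bar R}) (hhaar : padic_haar haar).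
Variables (b gamma : R) (b0 : 0 < b) (gamma0 : 0 < gamma).
Local Notation chi := (@padic_char R p hp).
Local Notation w := (ball_weight p b gamma).
Local Notation phi := (@stable_symbol R p hp b gamma).

(** The termwise Fourier transform of the symbol. *)
Definition stable_density (x : Qp) : R :=
  limn (series (fun i => w i * p%:R ^ zenum i * \1_(pball (- zenum i)) x)).
Local Notation f := stable_density.

Let wp_ge0 i : 0 <= w i * p%:R ^ zenum i.
Proof. by rewrite mulr_ge0 ?ball_weight_ge0 // exprz_ge0. Qed.

Let w_ge0 i : 0 <= w i. Proof. exact: ball_weight_ge0. Qed.

Lemma stable_density_series x :
  series (fun i => w i * p%:R ^ zenum i * \1_(pball (- zenum i)) x) @ \oo --> f x.
Proof.
apply: (@series_le_cvg _ _ (fun i => w i * p%:R ^ zenum i)) => [i|i|i|].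
- by rewrite mulr_ge0.
- exact: wp_ge0.
- by rewrite ler_piMr // indicE lern1 leq_b1.
- exact: ball_weightM_summable.
Qed.

Lemma stable_density_ge0 x : 0 <= f x.
Proof. exact: radial_ge0 wp_ge0 stable_density_series x. Qed.

Lemma stable_density_continuous : continuous f.
Proof.
apply: radial_continuous wp_ge0 stable_density_series _.
exact: ball_weightM_summable.
Qed.

Lemma stable_symbol_integrable : haar.-integrable setT (EFin \o phi).
Proof.
apply: radial_integrable (w_ge0) (@stable_symbol_series R p hp b gamma b0 gamma0) _ hhaar
  _.
exact: ball_weightM_summable.
Qed.

Lemma stable_symbol_fourier x :
  (\int[haar]_y (complex.Re (chi x y) * phi y))%R = f x /\
  (\int[haar]_y (complex.Im (chi x y) * phi y))%R = 0.
Proof.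
apply: radial_fourier (w_ge0) (@stable_symbol_series R p hp b gamma b0 gamma0) _ hhaar
  _ _ _ _.
- exact: ball_weightM_summable.
- exact: stable_density_series.
Qed.

Let weights_cancel i : w i * p%:R ^ zenum i * p%:R ^ (- zenum i) = w i.
Proof.
rewrite -mulrA -expfzDr ?subrr ?expr0z ?mulr1 //.
by rewrite gt_eqF // ltr0n prime_gt0.
Qed.

Let cancelled_summable :
  cvgn (series (fun i => w i * p%:R ^ zenum i * p%:R ^ (- zenum i))).
Proof.
rewrite (_ : (fun i => _) = w); first exact: ball_weight_summable.
by apply/funext => i; exact: weights_cancel.
Qed.

Lemma stable_density_integrable : haar.-integrable setT (EFin \o f).
Proof. exact: radial_integrable wp_ge0 stable_density_series _ hhaar _. Qed.

(** Fourier inversion: transforming a second time replaces the coefficient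
    [w_k p^k] by [w_k p^k p^-k = w_k], hence gives back the symbol. *)
Lemma stable_density_fourier y :
  (\int[haar]_x (complex.Re (chi y x) * f x))%R = phi y /\
  (\int[haar]_x (complex.Im (chi y x) * f x))%R = 0.
Proof.
apply: radial_fourier wp_ge0 stable_density_series _ hhaar _ _ _ _.
- exact: cancelled_summable.
- rewrite (_ : (fun i => _) = (fun i => w i * \1_(pball (zenum i)) y)).
    exact: stable_symbol_series.
  by apply/funext => i; rewrite weights_cancel opprK.
Qed.

Variable P : probability Qp R.
Hypothesis P_fourier : forall y, padic_fourier P y = (phi y)%:C.

(** The Fourier transform integrates [chi_y (- x)]; evaluating it at [- y] gives
    the integral of [chi_y x], and the symbol is even. *)
Lemma probability_fourier y :
  (\int[P]_x complex.Re (chi y x))%R = phi y /\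
  (\int[P]_x complex.Im (chi y x))%R = 0.
Proof.
have := P_fourier (- y); rewrite /padic_fourier /cintegral.
have chiN x : chi (- y) (- x) = chi y x by rewrite /padic_char mulrNN.
have -> : phi (- y) = phi y.
  by rewrite /stable_symbol /padic_abs padic_normN.
by case=> Re_phi Im_0; split; [rewrite -Re_phi|rewrite -[RHS]Im_0];
  apply: eq_Rintegral => x _; rewrite -(chiN x).
Qed.

Lemma probability_pball k a : P [set x | pball k (x - a)] =
  (\int[haar]_(x in [set x : Qp | pball k (x - a)%R]) (f x)%:E)%E.
Proof.
set B := [set x : Qp | _].
have mB : measurable B by exact: measurable_pball.
have i1 : P.-integrable setT (EFin \o (fun=> 1 : R)).
  exact: finite_measure_integrable_cst.
have ifB : haar.-integrable B (EFin \o f).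
  by apply: integrableS stable_density_integrable.
have := @ball_inversion R p hp haar f stable_density_integrable k a.
have := @ball_inversion R p hp P _ i1 k a.
rewrite (_ : weighted_cos haar f = weighted_cos P (fun=> 1)); last first.
  apply/funext => y; rewrite /weighted_cos (stable_density_fourier y).1.
  by rewrite -(probability_fourier y).1; apply: eq_Rintegral => x _; rewrite mulr1.
rewrite (_ : weighted_sin haar f = weighted_sin P (fun=> 1)); last first.
  apply/funext => y; rewrite /weighted_sin (stable_density_fourier y).2.
  by rewrite -(probability_fourier y).2; apply: eq_Rintegral => x _; rewrite mulr1.
move=> pl hl; have := cvg_unique (@Rhausdorff R) hl pl.
rewrite -/B Rintegral_cst // mul1r /Rintegral => E.
rewrite -[LHS]fineK ?fin_num_measure // -[fine (P B)]E fineK //.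
exact: integrable_fin_num.
Qed.

End StableDensity.

Theorem mainTheorem6 (R : realType) (p : nat) (hp : prime p)
    (haar : {measure set (padic hp) -> \bar R}) (hhaar : padic_haar haar)
    (C gamma : R) (hC : 0 < C) (hgamma : 0 < gamma)
    (rho : R -> probability (padic hp) R)
    (hrho : convolution_semigroup rho)
    (hfourier : forall (t : R) (y : padic hp), 0 <= t ->
      padic_fourier (rho t) y =
        (expR (- (C * t * padic_abs R y `^ gamma)))%:C) :
  forall t : R, 0 < t ->
    (forall x : padic hp, cintegrable haar (stable_integrand C gamma t x)) /\
    exists f : padic hp -> R,
      [/\ forall x : padic hp,
            (f x)%:C = cintegral haar (stable_integrand C gamma t x),
          continuous f,
          forall x : padic hp, 0 <= f x
        & forall A : set (padic hp), measurable A ->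
            rho t A = (\int[haar]_(x in A) (f x)%:E)%E].
Proof.
move=> t t0; have b0 : 0 < C * t by rewrite mulr_gt0.
pose phi := @stable_symbol R p hp (C * t) gamma.
have iphi : haar.-integrable setT (EFin \o phi).
  exact: stable_symbol_integrable.
have ReE x y : complex.Re (stable_integrand C gamma t x y) =
    complex.Re (padic_char R x y) * phi y.
  rewrite /stable_integrand -/(phi y) padic_charC.
  by case: (padic_char R x y) => u v /=; rewrite mulr0 subr0.
have ImE x y : complex.Im (stable_integrand C gamma t x y) =
    complex.Im (padic_char R x y) * phi y.
  rewrite /stable_integrand -/(phi y) padic_charC.
  by case: (padic_char R x y) => u v /=; rewrite mulr0 add0r.
split=> [x|].
  split.
    rewrite (_ : (fun y => _) = (fun y => complex.Re (padic_char R x y)) \* phi).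
      by apply: integrable_boundedM => //;
        [exact: measurable_Re_padic_char|move=> y; exact: Re_padic_char_le1].
    by apply/funext => y; rewrite ReE.
  rewrite (_ : (fun y => _) = (fun y => complex.Im (padic_char R x y)) \* phi).
    by apply: integrable_boundedM => //;
      [exact: measurable_Im_padic_char|move=> y; exact: Im_padic_char_le1].
  by apply/funext => y; rewrite ImE.
exists (@stable_density R p hp (C * t) gamma); split.
- move=> x; have [Re_f Im_0] := stable_symbol_fourier hhaar b0 hgamma x.
  rewrite /cintegral; congr (_ +i* _).
    by rewrite -Re_f; apply: eq_Rintegral => y _; rewrite ReE.
  by rewrite -[LHS]Im_0; apply: eq_Rintegral => y _; rewrite ImE.
- exact: stable_density_continuous.
- exact: stable_density_ge0.
- apply: density_of_pballs; last first.
  + move=> k a; apply: probability_pball => // y.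
    by rewrite hfourier // ltW.
  + exact: stable_density_ge0.
  + apply/measurable_EFinP.
    exact: measurable_int (stable_density_integrable hhaar b0 hgamma).
Qed.
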